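(* Let $\Gamma$ be a countable non-amenable group acting freely and minimally (by homeomorphisms) on the Cantor set $X$. Then the topological full group $[[\Gamma]]$ of $\Gamma\curvearrowright X$ is $C^\ast$-simple.
   Context: The topological full group $[[\Gamma]]$ of an action $\Gamma\curvearrowright X$ is the group of all homeomorphisms of $X$ that locally (in a neighbourhood of every point) coincide with an element of $\Gamma$. The action is minimal if every orbit is dense, and free if every point stabilizer is trivial. A group is $C^\ast$-simple if its reduced $C^\ast$-algebra is simple. *)

(* Defs.v *)
From HB Require Import structures.
From mathcomp Require Import all_boot all_order all_algebra complex ring.
From mathcomp Require Import all_classical all_reals all_analysis.

Set Implicit Arguments.
Unset Strict Implicit.
Unset Printing Implicit Defensive.

Import Order.TTheory GRing.Theory Num.Theory.
Import ComplexField.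
Local Open Scope classical_set_scope.
Local Open Scope ring_scope.

Definition homeomorphism (X Y : topologicalType) (f : X -> Y) : Prop :=
  continuous f /\
  exists g : Y -> X, [/\ continuous g, cancel f g & cancel g f].

Definition is_cantor_set (X : topologicalType) : Prop :=
  exists f : X -> cantor_space, homeomorphism f.

Record homeo (X : topologicalType) := Homeo {
  homeo_fun :> X -> X;
  homeo_funP : `[< homeomorphism homeo_fun >] }.

HB.instance Definition _ (X : topologicalType) :=
  [isSub for @homeo_fun X].
HB.instance Definition _ (X : topologicalType) :=
  [Choice of homeo X by <:].

Section HomeoGroup.
Variable X : topologicalType.
Implicit Types f g h : homeo X.

Lemma homeo_ext f g : (forall x, f x = g x) -> f = g.
Proof. by move=> fg; apply/val_inj/funext. Qed.

Lemma homeoP f : homeomorphism f.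
Proof. exact/asboolP/homeo_funP. Qed.

Lemma homeomorphism_id : homeomorphism (@idfun X).
Proof. by split=> [x //|]; exists idfun; split=> // x. Qed.

Definition homeo_one : homeo X := Homeo (asboolT homeomorphism_id).

Lemma homeomorphism_comp f g : homeomorphism (fun x => f (g x)).
Proof.
have [cf [f' [cf' fK f'K]]] := homeoP f.
have [cg [g' [cg' gK g'K]]] := homeoP g.
split=> [x|].
  by apply: (@continuous_comp _ _ _ g f x); [exact: cg | exact: cf].
exists (g' \o f'); split=> [x|x|x] /=.
- by apply: continuous_comp; [exact: cf' | exact: cg'].
- by rewrite fK gK.
- by rewrite g'K f'K.
Qed.

Definition homeo_mul f g : homeo X := Homeo (asboolT (homeomorphism_comp f g)).

Definition homeo_inv_fun f : X -> X := projT1 (cid (homeoP f).2).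

Lemma homeo_invK f : cancel f (homeo_inv_fun f).
Proof. by rewrite /homeo_inv_fun; case: cid => ? []. Qed.

Lemma homeo_invKV f : cancel (homeo_inv_fun f) f.
Proof. by rewrite /homeo_inv_fun; case: cid => ? []. Qed.

Lemma homeomorphism_inv f : homeomorphism (homeo_inv_fun f).
Proof.
split; last first.
  exists f.
  by split; [exact: (homeoP f).1 | exact: homeo_invKV | exact: homeo_invK].
by rewrite /homeo_inv_fun; case: cid => ? [].
Qed.

Definition homeo_inv f : homeo X := Homeo (asboolT (homeomorphism_inv f)).

Lemma homeo_mulA : associative homeo_mul.
Proof. by move=> f g h; exact: homeo_ext. Qed.
Lemma homeo_1mul : left_id homeo_one homeo_mul.
Proof. by move=> f; exact: homeo_ext. Qed.
Lemma homeo_mul1 : right_id homeo_one homeo_mul.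
Proof. by move=> f; exact: homeo_ext. Qed.
Lemma homeo_mulV : left_inverse homeo_one homeo_inv homeo_mul.
Proof. by move=> f; apply: homeo_ext => x; exact: homeo_invK. Qed.
Lemma homeo_mulVr : right_inverse homeo_one homeo_inv homeo_mul.
Proof. by move=> f; apply: homeo_ext => x; exact: homeo_invKV. Qed.

HB.instance Definition _ := isGroup.Build (homeo X)
  homeo_mulA homeo_1mul homeo_mul1 homeo_mulV homeo_mulVr.

Lemma homeo1E (x : X) : (1%g : homeo X) x = x. Proof. by []. Qed.
Lemma homeoME f g (x : X) : (f * g)%g x = f (g x). Proof. by []. Qed.
Lemma homeoVE f (x : X) : f (f^-1%g x) = x.
Proof. exact: homeo_invKV. Qed.
Lemma homeoVEl f (x : X) : f^-1%g (f x) = x.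
Proof. exact: homeo_invK. Qed.

End HomeoGroup.

(* An action by homeomorphisms is a group morphism into [homeo X]; for
   [a : homeo_action Gamma X], the point g.x is [a g x]. *)
Notation homeo_action Gamma X := (UMagmaMorphism.type Gamma (homeo X)).

Section Actions.
Variables (Gamma : groupType) (X : topologicalType).
Variable a : homeo_action Gamma X.

Definition point_orbit (x : X) : set X := [set a g x | g in setT].

Definition point_stabilizer (x : X) : set Gamma := [set g | a g x = x].

Definition minimal_action : Prop := forall x, dense (point_orbit x).

Definition free_action : Prop := forall x, point_stabilizer x = [set 1%g].

Definition locally_in_action (f : homeo X) : Prop :=
  forall x : X, exists g, \forall y \near x, f y = a g y.

Definition full_group_pred : {pred homeo X} :=
  fun f => `[< locally_in_action f >].

Lemma full_group_closed : group_closed full_group_pred.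
Proof.
split.
  apply/asboolP => x; exists 1%g; apply: nearW => y.
  by rewrite gmulf1.
move=> f h /asboolP fa /asboolP ha; apply/asboolP => x.
set z := h^-1%g x.
have [g1 g1P] := fa z; have [g2 g2P] := ha z.
have cVh : {for x, continuous (h^-1%g : X -> X)}.
  exact: (homeoP h^-1%g).1.
exists (g1 * g2^-1)%g.
have := cVh _ g1P; have := cVh _ g2P.
rewrite !nbhs_simpl /=; apply: filterS2 => y.
rewrite [X in X -> _](_ : _ = (h (h^-1%g y) = a g2 (h^-1%g y)))//.
rewrite [X in _ -> X -> _](_ : _ = (f (h^-1%g y) = a g1 (h^-1%g y)))//.
move=> hy fy; change (f (h^-1%g y) = a (g1 * g2^-1)%g y).
rewrite fy gmulfM homeoME; congr (a g1 _).
rewrite -[LHS]homeo1E -(gmulf1 (s := a)) -(mulVg g2) gmulfM homeoME.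
by rewrite -hy homeoVE.
Qed.

Record full_group := FullGroup {
  full_group_homeo :> homeo X;
  full_groupP : full_group_homeo \in full_group_pred }.

HB.instance Definition _ := [isSub for full_group_homeo].
HB.instance Definition _ := [Choice of full_group by <:].
HB.instance Definition _ :=
  SubChoice_isSubGroup.Build (homeo X) full_group_pred full_group
    full_group_closed.

End Actions.

(* A left-invariant finitely additive probability measure on all subsets. *)
Definition amenable (R : realType) (G : groupType) : Prop :=
  exists mu : set G -> R,
    [/\ forall A, 0 <= mu A,
        mu setT = 1,
        forall A B, A `&` B = set0 -> mu (A `|` B) = mu A + mu B
      & forall (g : G) A, mu [set (g * h)%g | h in A] = mu A].

Section ReducedCstarAlgebra.
Variables (R : realType) (G : groupType).

(* [R[i]] alone is canonically a module over [R]; the [^o] makes the scalars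
   complex. *)
Local Notation C := (R[i]^o).

Definition sqnorm (v : G -> C) : \bar R :=
  \esum_(g in [set: G]) ((Normc.normc (v g)) ^+ 2)%:E.

Definition l2_pred : {pred G -> C} := fun v => (sqnorm v < +oo)%E.

Lemma l2_submod_closed : submod_closed l2_pred.
Proof.
have lin (c : R[i]) (u v : G -> C) :
    (sqnorm (c *: u + v)%R <=
     (2 * Normc.normc c ^+ 2)%:E * sqnorm u + 2%:E * sqnorm v)%E.
  have n0 (z : R[i]) : 0 <= Normc.normc z.
    by case: z => x y; exact: sqrtr_ge0.
  have k0 : 0 <= 2 * Normc.normc c ^+ 2 by rewrite mulr_ge0 ?sqr_ge0.
  have esumZ (k : R) (w : G -> C) : 0 <= k ->
      (\esum_(g in [set: G]) (k%:E * (Normc.normc (w g) ^+ 2)%:E) <=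
       k%:E * sqnorm w)%E.
    move=> k1; apply: ge_ereal_sup => _ [A [finA AT] <-].
    rewrite -ge0_mule_fsumr; last by move=> i; rewrite lee_fin sqr_ge0.
    apply: lee_wpmul2l; rewrite ?lee_fin//.
    by apply: ereal_sup_ubound; exists A.
  apply: le_trans (leeD (esumZ _ u k0) (esumZ _ v (ler0n R 2))).
  rewrite -esumD; last 2 first.
  - by move=> i _; rewrite mule_ge0// lee_fin ?sqr_ge0.
  - by move=> i _; rewrite mule_ge0// lee_fin ?sqr_ge0.
  apply: le_esum => g _; rewrite -!EFinM -EFinD lee_fin.
  have -> : (c *: u + v) g = c * u g + v g :> R[i] by [].
  apply: (@le_trans _ _ ((Normc.normc (c * u g) + Normc.normc (v g)) ^+ 2)).
    by rewrite lerXn2r ?nnegrE ?n0 ?addr_ge0 ?n0//; exact: le_normcD.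
  rewrite Normc.normcM.
  set x := Normc.normc c; set y := Normc.normc (u g); set z := Normc.normc _.
  rewrite -subr_ge0.
  have -> : 2 * x ^+ 2 * y ^+ 2 + 2 * z ^+ 2 - (x * y + z) ^+ 2 =
            (x * y - z) ^+ 2 by ring.
  exact: sqr_ge0.
split.
  rewrite /in_mem /= /l2_pred /sqnorm esum1// => g _.
  by rewrite Normc.normc0 expr0n.
move=> c u v; rewrite /in_mem /= /l2_pred => uoo voo.
apply: le_lt_trans (lin c u v) _.
apply: lte_add_pinfty; apply: lte_mul_pinfty => //.
by rewrite lee_fin; apply: mulr_ge0 => //; exact: sqr_ge0.
Qed.

Record l2 := L2 {
  l2_fun :> G -> C;
  l2P : l2_fun \in l2_pred }.

HB.instance Definition _ := [isSub for l2_fun].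
HB.instance Definition _ := [Choice of l2 by <:].
HB.instance Definition _ :=
  GRing.SubChoice_isSubLmodule.Build R[i] (G -> C) l2_pred l2 l2_submod_closed.

Definition l2norm (v : l2) : R := Num.sqrt (fine (sqnorm v)).

Local Notation op := (l2 -> l2).

(* Equal to [+oo] when [T] is an unbounded linear operator. *)
Definition opnorm (T : op) : \bar R :=
  ereal_sup [set (l2norm (T v))%:E | v in [set v : l2 | l2norm v <= 1]].

Definition bounded_ops : set op :=
  [set T : op | linear T /\ (opnorm T < +oo)%E].

Definition op_closure (A : set op) : set op :=
  [set T | bounded_ops T /\
    forall e : R, 0 < e -> exists S, A S /\ (opnorm (T - S)%R < e%:E)%E].

Lemma left_translate_l2 (g : G) (v : l2) :
  (fun h => v (g^-1 * h)%g) \in l2_pred.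
Proof.
have := l2P v; rewrite /in_mem /= /l2_pred; congr (_ < _)%E.
rewrite /sqnorm (reindex_esum setT setT (fun h => g^-1 * h)%g)//.
split=> // [h1 h2 _ _|h _]; first exact: mulgI.
by exists (g * h)%g => //; rewrite mulKg.
Qed.

Definition left_regular (g : G) : op := fun v => L2 (left_translate_l2 g v).

Definition group_algebra : set op :=
  [set T | exists s : seq (R[i] * G),
             T = \sum_(p <- s) p.1 *: (left_regular p.2 : op)].

Definition reduced_Cstar : set op := op_closure group_algebra.

(* [A] is meant to be norm-closed, so that for [I `<=` A] the closure of [I] in
   the bounded operators is its closure in [A]. *)
Definition closed_ideal (A I : set op) : Prop :=
  [/\ I `<=` A,
      I 0,
      forall (c : R[i]) S T, I S -> I T -> I (c *: S + T),
      forall S T, A S -> I T -> I (S \o T) /\ I (T \o S)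
    & op_closure I `<=` I].

Definition Cstar_simple : Prop :=
  forall I, closed_ideal reduced_Cstar I -> I = [set 0] \/ I = reduced_Cstar.

End ReducedCstarAlgebra.

(* Main.v *)
Require Import Defs.
From mathcomp Require Import all_boot all_order all_algebra complex ring lra.
From mathcomp Require Import all_classical all_reals all_analysis.

(** The reduced C*-algebra of G = [[Gamma]] is simple because G has Powers'
    averaging property: for finitely many nontrivial elements t of G and any
    e > 0, there is one finite family of elements s of G such that the norm of
    the average of lambda(s t s^-1) over the family is at most e, for each of
    these t ([full_group_powers]).  Granting this, take a nonzero closed ideal.
    It contains an operator whose matrix coefficient at the identity is 1, and
    this operator is close to a finite combination of the lambda(t) in which the
    identity has a coefficient close to 1.  Averaging its conjugates damps all
    other terms, so the ideal contains an operator at distance less than 1 from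
    the identity, and by a Neumann series it contains the identity
    ([powers_Cstar_simple]).

    To average the conjugates of a single t <> 1, choose a nonempty clopen U
    with U and t U disjoint, and let s range over the rigid stabilizer of U.
    Then s t s^-1 = s (t s^-1 t^-1) t, where t s^-1 t^-1 lies in the rigid
    stabilizer of t U; the two rigid stabilizers commute and intersect
    trivially.  Whatever the second factor is, the sum of the
    lambda(s (t s^-1 t^-1)) has norm at most that of the sum of the lambda(s)
    ([fell_bound]), and the latter can be made small relative to the number of
    terms as soon as the rigid stabilizer carries no invariant mean, by Kesten's
    argument ([nonamenable_small_norm]).  Several elements t_1, ..., t_m are
    treated at once: as X has no isolated points, the sets U_1, ..., U_m can be
    chosen pairwise disjoint, and then the corresponding averages commute, so
    that their composition damps every t_j ([full_group_powers_avoiding]).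

    It remains to see that the rigid stabilizer H of a nonempty clopen U has no
    invariant mean ([rigid_stabilizer_mean]).  An H-invariant mean gives a mean
    on the orbit of a point of U, carried by U and invariant under H.  As the
    action is free, an element c <> 1 of Gamma moves every point, so the part of
    U that c maps into U splits into finitely many clopen pieces disjoint from
    their images; on each piece, c agrees with an involution in H that exchanges
    the piece with its image.  Hence the mean is invariant under all partial
    translations inside U.  By minimality and compactness finitely many
    translates of U cover X, and the mean extends to a Gamma-invariant one on
    the whole orbit, which is a copy of Gamma ([extend_mean]).  So Gamma would
    be amenable. *)
Set Implicit Arguments.
Unset Strict Implicit.
Unset Printing Implicit Defensive.

Import Order.TTheory GRing.Theory Num.Theory.
Import ComplexField numFieldNormedType.Exports.
Local Open Scope classical_set_scope.
Local Open Scope ring_scope.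

(** * The Hilbert space of square-summable functions on a group *)

Section SqNorm.
Variables (R : realType) (G : groupType).
Implicit Types (u v w : l2 R G) (g h s : G) (c : R[i]) (A : set G).

Lemma normc_ge0 (c : R[i]) : 0 <= Normc.normc c.
Proof. by case: c => x y; exact: sqrtr_ge0. Qed.

Lemma sqnorm_ge0 (v : G -> R[i]) : (0 <= sqnorm v)%E.
Proof. by apply: esum_ge0 => g _; rewrite lee_fin sqr_ge0. Qed.

Lemma sqnorm_fin v : (sqnorm v \is a fin_num).
Proof. by rewrite ge0_fin_numE ?sqnorm_ge0//; exact: l2P. Qed.

Lemma l2norm_ge0 v : 0 <= l2norm v.
Proof. exact: sqrtr_ge0. Qed.

Lemma l2norm_sqr v : (l2norm v ^+ 2)%:E = sqnorm v.
Proof.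
by rewrite sqr_sqrtr ?fine_ge0 ?sqnorm_ge0// fineK// sqnorm_fin.
Qed.

Lemma l2norm_le (v w : l2 R G) (M : R) : 0 <= M ->
  (sqnorm v <= (M ^+ 2)%:E * sqnorm w)%E -> l2norm v <= M * l2norm w.
Proof.
move=> M0; rewrite -!l2norm_sqr -EFinM lee_fin -exprMn.
by rewrite ler_pXn2r// nnegrE ?mulr_ge0// l2norm_ge0.
Qed.

Lemma l2D u v g : (u + v) g = u g + v g. Proof. by []. Qed.
Lemma l2N u g : (- u) g = - u g. Proof. by []. Qed.
Lemma l2B u v g : (u - v) g = u g - v g. Proof. by []. Qed.
Lemma l2Z c u g : (c *: u) g = c * u g. Proof. by []. Qed.
Lemma l20 g : (0 : l2 R G) g = 0. Proof. by []. Qed.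
Lemma l2_ext u v : (forall g, u g = v g) -> u = v.
Proof. by move=> uv; apply/val_inj/funext. Qed.


Lemma l2sum_val (I : Type) (r : seq I) (P : pred I) (F : I -> l2 R G) g :
  (\sum_(i <- r | P i) F i) g = \sum_(i <- r | P i) (F i g : R[i]).
Proof. exact: (big_morph (fun u : l2 R G => u g : R[i])). Qed.

Lemma esumZ_le (T : choiceType) (A : set T) (k : R) (f : T -> \bar R) :
  0 <= k -> (forall i, (0 <= f i)%E) ->
  (\esum_(i in A) (k%:E * f i) <= k%:E * \esum_(i in A) f i)%E.
Proof.
move=> k0 f0; apply: ge_ereal_sup => _ [B BA <-].
rewrite -ge0_mule_fsumr//; apply: lee_wpmul2l; rewrite ?lee_fin//.
by apply: ereal_sup_ubound; exists B.
Qed.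

Lemma normc_le_l2norm v g : Normc.normc (v g) <= l2norm v.
Proof.
rewrite -(@ler_pXn2r _ 2)// ?nnegrE ?normc_ge0 ?l2norm_ge0//.
rewrite -lee_fin l2norm_sqr; apply: esum_ge; exists [set g].
  by split=> //; exact: finite_set1.
by rewrite fsbig_set1.
Qed.

Lemma l2norm_eq0 v : l2norm v = 0 -> v = 0.
Proof.
move=> v0; apply: l2_ext => g; apply: Normc.eq0_normc; apply/eqP.
by rewrite eq_le normc_ge0 -v0 normc_le_l2norm.
Qed.

Lemma l2norm0 : l2norm (0 : l2 R G) = 0.
Proof.
apply/eqP; rewrite -sqrf_eq0 -eqe l2norm_sqr; apply/eqP/esum1 => g _.
by rewrite l20 Normc.normc0 expr0n.
Qed.

Lemma sqnorm_le (f h : G -> R[i]) :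
  (forall g, Normc.normc (f g) <= Normc.normc (h g)) ->
  (sqnorm f <= sqnorm h)%E.
Proof.
move=> fh; apply: le_esum => g _; rewrite lee_fin.
by rewrite ler_pXn2r// nnegrE normc_ge0.
Qed.

Lemma l2normZ_le c v : l2norm (c *: v) <= Normc.normc c * l2norm v.
Proof.
apply: l2norm_le; rewrite ?normc_ge0//.
apply: le_trans (esumZ_le _ (sqr_ge0 _) _) => [|g]; last first.
  by rewrite lee_fin sqr_ge0.
by apply: le_esum => g _; rewrite -EFinM lee_fin -exprMn -Normc.normcM l2Z.
Qed.

Lemma l2normN v : l2norm (- v) = l2norm v.
Proof.
rewrite /l2norm; congr (Num.sqrt (fine _)).
by apply: eq_esum => g _; rewrite l2N normcN.
Qed.

(** Young's inequality holds coordinate by coordinate; choosing t afterwards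
    gives the triangle inequality without any scalar product. *)
Lemma sqnormD_le (t : R) u v : 0 < t ->
  (sqnorm (u + v)%R <=
     (1 + t)%:E * sqnorm u + (1 + t^-1)%:E * sqnorm v)%E.
Proof.
move=> t0; have t1 : 0 < t^-1 by rewrite invr_gt0.
have sq0 (f : G -> R[i]) g : (0 <= ((Normc.normc (f g)) ^+ 2)%:E)%E.
  by rewrite lee_fin sqr_ge0.
apply: (@le_trans _ _ (\esum_(g in [set: G])
    ((1 + t)%:E * (Normc.normc (u g) ^+ 2)%:E) +
   \esum_(g in [set: G]) ((1 + t^-1)%:E * (Normc.normc (v g) ^+ 2)%:E))%E);
  last first.
  by apply: leeD; apply: esumZ_le => //; rewrite addr_ge0// ltW.
rewrite -esumD; first last.
- by move=> g _; rewrite mule_ge0// lee_fin addr_ge0// ltW.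
- by move=> g _; rewrite mule_ge0// lee_fin addr_ge0// ltW.
apply: le_esum => g _; rewrite -!EFinM -EFinD lee_fin l2D.
set x := Normc.normc (u g); set y := Normc.normc (v g).
apply: (@le_trans _ _ ((x + y) ^+ 2)).
  rewrite ler_pXn2r ?nnegrE ?normc_ge0// ?addr_ge0 ?normc_ge0//.
  exact: le_normcD.
rewrite -subr_ge0.
have -> : (1 + t) * x ^+ 2 + (1 + t^-1) * y ^+ 2 - (x + y) ^+ 2 =
    t * (x - t^-1 * y) ^+ 2.
  by field; rewrite gt_eqF.
by rewrite mulr_ge0 ?sqr_ge0// ltW.
Qed.

Lemma l2normD u v : l2norm (u + v) <= l2norm u + l2norm v.
Proof.
have [/l2norm_eq0 ->|u0] := eqVneq (l2norm u) 0.
  by rewrite add0r lerDr l2norm_ge0.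
have [/l2norm_eq0 ->|v0] := eqVneq (l2norm v) 0.
  by rewrite addr0 lerDl l2norm_ge0.
have {}u0 : 0 < l2norm u by rewrite lt_neqAle eq_sym u0 l2norm_ge0.
have {}v0 : 0 < l2norm v by rewrite lt_neqAle eq_sym v0 l2norm_ge0.
(* t = |v| / |u| is the value at which Young's inequality is sharp. *)
have := sqnormD_le u v (divr_gt0 v0 u0).
rewrite -!l2norm_sqr -!EFinM -EFinD lee_fin.
set x := l2norm u in u0 *; set y := l2norm v in v0 *.
have -> : (1 + y / x) * x ^+ 2 + (1 + (y / x)^-1) * y ^+ 2 = (x + y) ^+ 2.
  by field; rewrite !gt_eqF.
by rewrite ler_pXn2r ?nnegrE ?l2norm_ge0// addr_ge0// ltW.
Qed.

Lemma l2normB u v : l2norm (u - v) <= l2norm u + l2norm v.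
Proof. by rewrite -(l2normN v); exact: l2normD. Qed.

Lemma l2norm_sum (I : Type) (r : seq I) (P : pred I) (F : I -> l2 R G) :
  l2norm (\sum_(i <- r | P i) F i) <= \sum_(i <- r | P i) l2norm (F i).
Proof.
elim/big_rec2: _ => [|i y x _ xy]; first by rewrite l2norm0.
by apply: le_trans (l2normD _ _) _; rewrite lerD2l.
Qed.

Lemma parallelogram u v :
  l2norm (u + v) ^+ 2 + l2norm (u - v) ^+ 2 =
  2 * (l2norm u ^+ 2 + l2norm v ^+ 2).
Proof.
have sq0 (f : G -> R[i]) g : (0 <= ((Normc.normc (f g)) ^+ 2)%:E)%E.
  by rewrite lee_fin sqr_ge0.
apply: EFin_inj.
rewrite mulr2n mulrDl mul1r !EFinD !l2norm_sqr /sqnorm -!esumD//;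
  try by move=> g _; rewrite ?adde_ge0.
apply: eq_esum => g _; rewrite -!EFinD l2D l2B; congr EFin.
case: (u g) => a b; case: (v g) => c d; rewrite /Normc.normc /=.
rewrite !sqr_sqrtr ?addr_ge0 ?sqr_ge0//; ring.
Qed.

Lemma left_regularE g v h : left_regular g v h = v (g^-1 * h)%g.
Proof. by []. Qed.

Lemma left_regular_linear g : linear (@left_regular R G g).
Proof. by move=> c u v; apply: l2_ext. Qed.

Lemma left_regular1 v : left_regular 1%g v = v.
Proof. by apply: l2_ext => h; rewrite left_regularE invg1 mul1g. Qed.

Lemma left_regularM g h v :
  left_regular (g * h)%g v = left_regular g (left_regular h v).
Proof. by apply: l2_ext => k; rewrite !left_regularE invgM mulgA. Qed.

Lemma l2norm_left_regular g v : l2norm (left_regular g v) = l2norm v.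
Proof.
rewrite /l2norm; congr (Num.sqrt (fine _)).
rewrite /sqnorm [RHS](reindex_esum setT setT (fun h => g^-1 * h)%g)//.
split=> // [h1 h2 _ _|h _]; first exact: mulgI.
by exists (g * h)%g => //; rewrite mulKg.
Qed.

Definition delta_fun h : G -> R[i] := fun g => (g == h)%:R.

Lemma sqnorm_delta h : sqnorm (delta_fun h) = 1%E.
Proof.
rewrite /sqnorm (esumID [set h]); last by move=> g _; rewrite lee_fin sqr_ge0.
rewrite setTI esum_set1; last by rewrite lee_fin sqr_ge0.
rewrite /delta_fun eqxx Normc.normc1 expr1n esum1 ?adde0// => g [_ /= /eqP].
by move=> /negbTE ->; rewrite Normc.normc0 expr0n.
Qed.

Lemma delta_l2 h : delta_fun h \in @l2_pred R G.
Proof. by rewrite /in_mem /= /l2_pred sqnorm_delta ltry. Qed.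

Definition delta h : l2 R G := L2 (delta_l2 h).

Lemma deltaE h g : delta h g = (g == h)%:R. Proof. by []. Qed.

Lemma l2norm_delta h : l2norm (delta h) = 1.
Proof. by rewrite /l2norm sqnorm_delta sqrtr1. Qed.

Lemma left_regular_delta g h : left_regular g (delta h) = delta (g * h)%g.
Proof.
apply: l2_ext => k; rewrite left_regularE !deltaE.
by rewrite (can2_eq (mulVKg g) (mulKg g)).
Qed.

Lemma finite_support_dense v (e : R) : 0 < e ->
  exists s : seq G, l2norm (v - \sum_(h <- s) v h *: delta h) <= e.
Proof.
move=> e0; have e20 : 0 < e ^+ 2 by rewrite exprn_gt0.
have [_ [A [finA _] <-]] := ub_ereal_sup_adherent e20 (sqnorm_fin v).
move=> vA.
have /finite_seqP[s As] := finA.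
have inA h : (h \in undup s) = (h \in A).
  by rewrite mem_undup As; apply/idP/idP; rewrite inE.
exists (undup s).
set w := v - _.
(* w is v restricted to the complement of A, so its squared norm is the tail
   of the sum of v outside A. *)
have wE g : w g = if g \in A then 0 else v g.
  rewrite l2B l2sum_val; case: ifPn => gA; last first.
    rewrite big_seq big1 ?subr0// => h; rewrite inA => hA.
    rewrite l2Z deltaE; case: eqP => [gh|]; last by rewrite mulr0.
    by move: gA; rewrite gh hA.
  rewrite (bigD1_seq g) ?inA ?undup_uniq// l2Z deltaE eqxx mulr1.
  rewrite big1 => [|h hg]; first by rewrite /= addr0 subrr.
  by rewrite l2Z deltaE eq_sym (negbTE hg) mulr0.
have : (sqnorm v - (e ^+ 2)%:E <
  \sum_(x \in A) (Normc.normc (v x) ^+ 2)%:E)%E := vA.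
rewrite {1}/sqnorm (esumID A); last first.
  by move=> g _; rewrite lee_fin sqr_ge0.
rewrite !setTI esum_fset//; last by move=> g _; rewrite lee_fin sqr_ge0.
set S := (\sum_(_ \in A) _)%E; set T := esum _ _.
have -> : T = sqnorm w.
  rewrite /T esum_mkcond; apply: eq_esum => g _.
  by rewrite wE in_setC; case: (g \in A) => //; rewrite Normc.normc0 expr0n.
have : S \is a fin_num.
  by rewrite /S fsbig_finite// sumEFin.
rewrite -l2norm_sqr; case: S => // r _.
rewrite -EFinN -!EFinD lte_fin -addrA -[ltRHS]addr0 ltrD2l subr_lt0 => we.
by rewrite -(@ler_pXn2r _ 2)// ?nnegrE ?l2norm_ge0//; exact: ltW.
Qed.

End SqNorm.

(** * Powers averaging implies simplicity *)

Lemma exprn_lt_exists (R : realType) (r e : R) :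
  0 <= r < 1 -> 0 < e -> exists n, r ^+ n < e.
Proof.
move=> /andP[r0 r1] e0.
have /cvgrPdist_lt/(_ e e0)[n _ /(_ n (leqnn n))] :
  (r ^+ n @[n --> \oo] --> (0 : R)) by apply: cvg_expr; rewrite ger0_norm.
by rewrite /= sub0r normrN ger0_norm ?exprn_ge0// => ?; exists n.
Qed.

Section Powers.
Variables (R : realType) (G : groupType).
Local Notation op := (l2 R G -> l2 R G).
Implicit Types (u v w : l2 R G) (g h s t : G) (c : R[i]) (T : op).

Lemma normc_real (x : R) : Normc.normc x%:C%C = `|x|.
Proof. by rewrite /Normc.normc /= expr0n addr0 sqrtr_sqr. Qed.

Lemma normalize_l2 v : l2norm v != 0 ->
  exists2 w, l2norm w = 1 & v = (l2norm v)%:C%C *: w.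
Proof.
move=> v0; pose w := ((l2norm v)^-1)%:C%C *: v.
have vp : 0 < l2norm v by rewrite lt_neqAle eq_sym v0 l2norm_ge0.
have vw : v = (l2norm v)%:C%C *: w.
  by rewrite scalerA -rmorphM /= mulfV// scale1r.
exists w => //; apply/eqP; rewrite eq_le; apply/andP; split.
  apply: le_trans (l2normZ_le _ _) _.
  by rewrite normc_real ger0_norm ?invr_ge0 ?l2norm_ge0// mulVf.
rewrite -(ler_pM2l vp) mulr1 {1}vw; apply: le_trans (l2normZ_le _ _) _.
by rewrite normc_real ger0_norm// ltW.
Qed.

Lemma lin0 T : linear T -> T 0 = 0.
Proof.
by move=> lT; have := lT (-1) 0 0; rewrite !scaler0 addr0 scaleN1r addNr.
Qed.

Lemma linZ T c v : linear T -> T (c *: v) = c *: T v.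
Proof. by move=> lT; rewrite -[c *: v]addr0 lT lin0// addr0. Qed.

Lemma linD T u v : linear T -> T (u + v) = T u + T v.
Proof. by move=> lT; rewrite -[u]scale1r lT !scale1r. Qed.

Lemma linB T u v : linear T -> T (u - v) = T u - T v.
Proof. by move=> lT; rewrite -scaleN1r addrC lT scaleN1r addrC. Qed.

Lemma lin_sum (I : Type) (r : seq I) (P : pred I) (F : I -> l2 R G) T :
  linear T -> T (\sum_(i <- r | P i) F i) = \sum_(i <- r | P i) T (F i).
Proof.
move=> lT; apply: (big_morph T) => [u v|]; [exact: linD | exact: lin0].
Qed.

Lemma opsumE (I : Type) (r : seq I) (P : pred I) (F : I -> op) v :
  (\sum_(i <- r | P i) F i) v = \sum_(i <- r | P i) F i v.
Proof. exact: (big_morph (fun T : op => T v)). Qed.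

Lemma opnorm_le T (M : R) : 0 <= M ->
  (forall v, l2norm (T v) <= M * l2norm v) -> (opnorm T <= M%:E)%E.
Proof.
move=> M0 TM; apply: ge_ereal_sup => _ [v v1 <-]; rewrite lee_fin.
by apply: le_trans (TM v) _; rewrite ler_piMr.
Qed.

Lemma opnorm_bound T (M : R) : linear T -> (opnorm T <= M%:E)%E ->
  forall v, l2norm (T v) <= M * l2norm v.
Proof.
move=> lT TM v; have [/l2norm_eq0 ->|v0] := eqVneq (l2norm v) 0.
  by rewrite lin0// l2norm0 mulr0.
have [w w1 vw] := normalize_l2 v0.
rewrite vw linZ// -{}vw; apply: le_trans (l2normZ_le _ _) _.
rewrite normc_real ger0_norm ?l2norm_ge0// mulrC.
apply: ler_wpM2r; first exact: l2norm_ge0.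
rewrite -lee_fin; apply: le_trans TM; apply: ereal_sup_ubound; exists w => //.
by rewrite /= w1.
Qed.

Lemma bounded_ops_bound T : bounded_ops T ->
  exists2 M : R, 0 < M & forall v, l2norm (T v) <= M * l2norm v.
Proof.
move=> [lT Too].
have T0 : (0 <= opnorm T)%E.
  apply: ereal_sup_ubound; exists 0; first by rewrite /= l2norm0.
  by rewrite lin0// l2norm0.
have Tfin : opnorm T \is a fin_num by rewrite ge0_fin_numE.
exists (fine (opnorm T) + 1); first by rewrite ltr_wpDl// fine_ge0.
by apply: opnorm_bound => //; rewrite EFinD fineK// leeDl// lee_fin.
Qed.

Lemma bound_bounded_ops T (M : R) : 0 <= M -> linear T ->
  (forall v, l2norm (T v) <= M * l2norm v) -> bounded_ops T.
Proof.
by move=> M0 lT TM; split=> //; apply: le_lt_trans (opnorm_le M0 TM) (ltry _).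
Qed.

Lemma left_regular_reduced g : reduced_Cstar (@left_regular R G g).
Proof.
split.
  apply: (@bound_bounded_ops _ 1) => //; first exact: left_regular_linear.
  by move=> v; rewrite l2norm_left_regular mul1r.
move=> e e0; exists (left_regular g); split.
  by exists [:: (1, g)]; rewrite big_seq1 scale1r.
rewrite subrr; apply: le_lt_trans (_ : _ <= 0%:E)%E _; last by rewrite lte_fin.
by apply: opnorm_le => // v; rewrite l2norm0 mul0r.
Qed.

(** The point masses span a dense subspace. *)
Lemma op_eq0 T : bounded_ops T -> (forall h, T (delta R h) = 0) -> T = 0.
Proof.
move=> Tb T0; have [lT _] := Tb; have [M M0 TM] := bounded_ops_bound Tb.
apply/funext => v; apply: l2norm_eq0; apply/eqP; rewrite eq_le l2norm_ge0 andbT.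
apply/ler_addgt0Pr => e e0; rewrite add0r.
have [s sv] := finite_support_dense v (divr_gt0 e0 M0).
set w := \sum_(_ <- _) _ in sv.
have Tw : T w = 0.
  by rewrite lin_sum// big1// => h _; rewrite linZ// T0 scaler0.
have -> : T v = T (v - w) by rewrite linB// Tw subr0.
apply: le_trans (TM _) _; rewrite mulrC -ler_pdivlMr//.
Qed.

(** Powers' averaging property, with sums instead of averages: one family p
    serves all the elements of ts. *)
Definition powers_property := forall ts : seq G, 1%g \notin ts ->
  forall e : R, 0 < e -> exists p : seq G, 0 < (size p)%:R :> R /\
  forall t, t \in ts -> forall v,
  l2norm (\sum_(s <- p) left_regular (s * t * s^-1)%g v) <=
  e * (size p)%:R * l2norm v.

Section Ideal.
Variable I : set op.
Hypothesis Iid : closed_ideal (@reduced_Cstar R G) I.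

Lemma ideal_sub T : I T -> reduced_Cstar T.
Proof. by case: Iid => IA _ _ _ _; exact: IA. Qed.

Lemma ideal_bounded T : I T -> bounded_ops T.
Proof. by move=> /ideal_sub[]. Qed.

Lemma ideal0 : I 0. Proof. by case: Iid. Qed.

Lemma idealD S T : I S -> I T -> I (S + T).
Proof. by case: Iid => _ _ lin _ _ *; rewrite -[S]scale1r; exact: lin. Qed.

Lemma idealZ c T : I T -> I (c *: T).
Proof.
by case: Iid => _ I0 lin _ _ *; rewrite -[c *: T]addr0; exact: lin.
Qed.

Lemma idealB S T : I S -> I T -> I (S - T).
Proof.
by move=> IS IT; apply: idealD => //; rewrite -scaleN1r; exact: idealZ.
Qed.

Lemma ideal_sum (J : Type) (r : seq J) (F : J -> op) :
  (forall j, I (F j)) -> I (\sum_(j <- r) F j).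
Proof.
by move=> IF; elim/big_ind: _ => //; [exact: ideal0 | exact: idealD].
Qed.

Lemma ideal_compl S T : reduced_Cstar S -> I T -> I (S \o T).
Proof. by case: Iid => _ _ _ id _ SA IT; exact: (id _ _ SA IT).1. Qed.

Lemma ideal_compr S T : reduced_Cstar S -> I T -> I (T \o S).
Proof. by case: Iid => _ _ _ id _ SA IT; exact: (id _ _ SA IT).2. Qed.

Lemma ideal_translates g h T : I T ->
  I (@left_regular R G g \o T \o @left_regular R G h).
Proof.
move=> IT; apply: ideal_compr; first exact: left_regular_reduced.
by apply: ideal_compl => //; exact: left_regular_reduced.
Qed.

Lemma ideal_eq : I idfun -> I = reduced_Cstar (G := G).
Proof.
move=> I1; apply/seteqP; split=> [T|T TA]; first exact: ideal_sub.
exact: (ideal_compl TA I1).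
Qed.

(** The partial sums 1 - (1 - S)^n of the Neumann series for S^-1 S are
    multiples of S, hence lie in the ideal, and they converge to 1. *)
Lemma neumann_ideal S (r : R) : I S -> 0 <= r < 1 ->
  (forall v, l2norm (v - S v) <= r * l2norm v) -> I idfun.
Proof.
move=> IS /andP[r0 r1] Sr.
(* With T_0 = 0 and 1 - T_(n+1) = (1 - T_n)(1 - S), T_n stays in the ideal;
   multiplying out avoids mentioning the identity, not yet known to be there. *)
have key n : exists2 T, I T & forall v, l2norm (v - T v) <= r ^+ n * l2norm v.
  elim: n => [|n [T IT Tn]].
    exists 0; first exact: ideal0.
    by move=> v; rewrite subr0 expr0 mul1r.
  exists (T - (T \o S) + S).
    apply: idealD => //; apply: idealB => //.
    by apply: ideal_compl => //; exact: ideal_sub.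
  move=> v; have [lT _] := ideal_bounded IT.
  have -> : v - (T - (T \o S) + S) v = (v - S v) - T (v - S v).
    rewrite linB//.
    have -> : (T - (T \o S) + S) v = T v - T (S v) + S v by [].
    by rewrite opprD addrA addrAC.
  apply: le_trans (Tn _) _; rewrite exprSr -mulrA.
  by apply: ler_wpM2l => //; exact: exprn_ge0.
case: Iid => _ _ _ _; apply; split.
  apply: (@bound_bounded_ops _ 1) => // v; by rewrite mul1r.
move=> e e0.
have [|n rn] := @exprn_lt_exists _ r e _ e0; first exact/andP.
have [T IT Tn] := key n; exists T; split=> //.
apply: le_lt_trans (_ : _ <= (r ^+ n)%:E)%E _; last by rewrite lte_fin.
by apply: opnorm_le => //; exact: exprn_ge0.
Qed.

End Ideal.
Lemma sum_const_seq (V : lmodType R[i]) (T : Type) (r : seq T) (x : V) :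
  \sum_(i <- r) x = (size r)%:R *: x.
Proof. by rewrite big_const_seq count_predT iter_addr_0 scaler_nat. Qed.

(** A nonzero a in the ideal has a nonzero matrix coefficient c at (g, h);
    b = c^-1 lambda(g^-1) a lambda(h) then has coefficient 1 at the identity.
    Averaging conjugates of b over a Powers family adapted to a group algebra
    element near b brings it within 3/4 of the identity. *)
Lemma powers_Cstar_simple : powers_property -> @Cstar_simple R G.
Proof.
move=> pow I Iid.
have [[a Ia a0]|noI] := pselect (exists2 T, I T & T <> 0); last first.
  left; apply/seteqP; split=> [T IT|_ ->]; last exact: ideal0.
  by apply: contrapT => T0; apply: noI; exists T.
right; apply: (ideal_eq Iid).
have [h [g cne0]] : exists h g, a (delta R h) g != 0.
  apply: contrapT => no; apply: a0; apply: op_eq0 (ideal_bounded Iid Ia) _ => h.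
  apply: l2_ext => g; apply/eqP; apply: contrapT => /negP ne0.
  by apply: no; exists h, g.
set c := a (delta R h) g in cne0.
pose b : op :=
  c^-1 *: (@left_regular R G g^-1%g \o a \o @left_regular R G h).
have Ib : I b by apply: (idealZ Iid); exact: (ideal_translates Iid).
have [lb _] := ideal_bounded Iid Ib.
have b1 : b (delta R 1%g) 1%g = 1.
  have -> : b (delta R 1%g) =
    c^-1 *: left_regular g^-1%g (a (left_regular h (delta R 1%g))) by [].
  by rewrite left_regular_delta mulg1 l2Z left_regularE invgK mulg1 mulVf.
have [_ appr] := ideal_sub Iid Ib.
(* Each of three errors below is at most 1/4: the distance of b to S, that of
   the identity coefficient d of S to 1, and the averaged remainder of S. *)
have [S [[s Ss] bS]] := appr 4^-1 ltac:(by rewrite invr_gt0).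
have SE v : S v = \sum_(p <- s) p.1 *: left_regular p.2 v.
  by rewrite Ss opsumE.
have lS : linear S.
  move=> k u v; rewrite !SE scaler_sumr -big_split /=; apply: eq_bigr => p _.
  by rewrite left_regular_linear scalerDr !scalerA mulrC.
have lbS : linear (b - S).
  move=> k u v; have -> w : (b - S) w = b w - S w by [].
  by rewrite lb lS scalerBr opprD addrACA.
have bSv := opnorm_bound lbS (ltW bS).
pose d := \sum_(p <- s | p.2 == 1%g) p.1.
have S1 : S (delta R 1%g) 1%g = d.
  rewrite SE l2sum_val /d [RHS]big_mkcond; apply: eq_bigr => p _.
  rewrite l2Z left_regular_delta deltaE mulg1 eq_sym.
  by case: eqP; rewrite ?mulr1 ?mulr0.
have d1 : Normc.normc (1 - d) <= 4^-1.
  have -> : 1 - d = ((b - S) (delta R 1%g)) 1%g.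
    have -> : (b - S) (delta R 1%g) = b (delta R 1%g) - S (delta R 1%g) by [].
    by rewrite l2B b1 S1.
  apply: le_trans (normc_le_l2norm _ _) _; apply: le_trans (bSv _) _.
  by rewrite l2norm_delta mulr1.
pose C := \sum_(p <- s) Normc.normc p.1.
have C0 : 0 <= C by apply: sumr_ge0 => p _; exact: normc_ge0.
(* The remainder of S is a combination of total mass at most C; adding 1 covers
   the case C = 0. *)
have e0 : 0 < (4 * (C + 1))^-1 :> R by rewrite invr_gt0 mulr_gt0// ltr_wpDl.
have [|q [q0 qP]] := pow [seq p.2 | p <- s & p.2 != 1%g] _ _ e0.
  by apply/mapP => -[p]; rewrite mem_filter => /andP[/eqP p1 _] /esym.
set n := size q in q0 qP.
pose X : op :=
  \sum_(t <- q) (@left_regular R G t \o b \o @left_regular R G t^-1%g).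
have IX : I X.
  by apply: (ideal_sum Iid) => t; exact: (ideal_translates Iid).
apply: (@neumann_ideal _ Iid (((n%:R : R)^-1)%:C%C *: X) (3 / 4)).
- exact: (idealZ Iid).
- apply/andP; split; first by rewrite divr_ge0.
  by rewrite ltr_pdivrMr// mul1r ltr_nat.
move=> v.
have nX : l2norm (n%:R *: v - X v) <= 3 / 4 * (n%:R * l2norm v).
  have -> : n%:R *: v - X v =
      (n%:R *: ((1 - d) *: v)
      - \sum_(p <- s | p.2 != 1%g)
          p.1 *: \sum_(t <- q) left_regular (t * p.2 * t^-1)%g v)
      - \sum_(t <- q) left_regular t ((b - S) (left_regular t^-1%g v)).
    have -> : X v = \sum_(t <- q) left_regular t (S (left_regular t^-1%g v)) +
       \sum_(t <- q) left_regular t ((b - S) (left_regular t^-1%g v)).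
      rewrite /X opsumE -big_split /=; apply: eq_bigr => t _.
      rewrite -linD; last exact: left_regular_linear.
      by congr left_regular; rewrite addrC subrK.
    rewrite opprD addrA; congr (_ - _).
    under [in RHS]eq_bigr do rewrite scaler_sumr.
    rewrite exchange_big /= -!sum_const_seq -!sumrB; apply: eq_bigr => t _.
    rewrite SE lin_sum; last exact: left_regular_linear.
    rewrite (bigID (fun p => p.2 == 1%g)) /= opprD addrA; congr (_ - _).
      rewrite scalerBl scale1r /d scaler_suml; congr (_ - _).
      apply: eq_bigr => p /eqP p1.
      rewrite linZ; last exact: left_regular_linear.
      by rewrite p1 left_regular1 -left_regularM mulgV left_regular1.
    apply: eq_bigr => p _; rewrite linZ; last exact: left_regular_linear.
    by rewrite -!left_regularM.
  apply: le_trans (l2normB _ _) _.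
  apply: le_trans (lerD (l2normB _ _) (lexx _)) _.
  have m0 : 0 <= n%:R * l2norm v by rewrite mulr_ge0 ?l2norm_ge0.
  have -> : 3 / 4 * (n%:R * l2norm v) = 4^-1 * (n%:R * l2norm v) +
     4^-1 * (n%:R * l2norm v) + 4^-1 * (n%:R * l2norm v) by field.
  apply: lerD; first apply: lerD.
  - rewrite scalerA; apply: le_trans (l2normZ_le _ _) _.
    rewrite mulrA ler_wpM2r ?l2norm_ge0// mulrC Normc.normcM.
    rewrite ler_pM ?normc_ge0//.
    have -> : (n%:R : R[i]) = (n%:R)%:C%C by rewrite rmorph_nat.
    by rewrite normc_real ger0_norm.
  - apply: le_trans (l2norm_sum _ _ _) _.
    pose K := (4 * (C + 1))^-1 * n%:R * l2norm v.
    have K0 : 0 <= K by rewrite !mulr_ge0 ?l2norm_ge0// ltW.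
    apply: (@le_trans _ _ (C * K)).
      rewrite /C mulr_suml [leLHS]big_mkcond /= !big_seq.
      apply: ler_sum => p ps.
      case: ifPn => p1; last by rewrite mulr_ge0// normc_ge0.
      apply: le_trans (l2normZ_le _ _) _.
      apply: ler_wpM2l; first exact: normc_ge0.
      by apply: qP; apply/mapP; exists p => //; rewrite mem_filter p1.
    have C1 : 0 < C + 1 by rewrite ltr_wpDl.
    have -> : C * K = 4^-1 * (n%:R * l2norm v) * (C / (C + 1)).
      by rewrite /K; field; rewrite gt_eqF.
    apply: ler_piMr; first by rewrite mulr_ge0.
    by rewrite ler_pdivrMr// mul1r lerDl.
  - apply: le_trans (l2norm_sum _ _ _) _.
    apply: (@le_trans _ _ (\sum_(t <- q) 4^-1 * l2norm v)).
      apply: ler_sum => t _; rewrite l2norm_left_regular.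
      by apply: le_trans (bSv _) _; rewrite l2norm_left_regular.
    rewrite big_const_seq count_predT iter_addr_0 -[leLHS]mulr_natl.
    by rewrite mulrCA lexx.
have nC : ((n%:R : R)^-1)%:C%C * n%:R = 1 :> R[i].
  have -> : (n%:R : R[i]) = (n%:R)%:C%C by rewrite rmorph_nat.
  by rewrite -rmorphM /= mulVf ?gt_eqF.
have -> : v - (((n%:R : R)^-1)%:C%C *: X) v =
    ((n%:R : R)^-1)%:C%C *: (n%:R *: v - X v).
  by rewrite scalerBr scalerA nC scale1r.
apply: le_trans (l2normZ_le _ _) _; rewrite normc_real ger0_norm ?invr_ge0//.
by rewrite mulrC ler_pdivrMr// -mulrA [l2norm v * _]mulrC.
Qed.

End Powers.

(** * From almost invariant vectors to invariant means *)

Section UltraLimit.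
Variable R : realType.

(** A cluster point of an ultrafilter is a limit: no set and its complement can
    both fail to be in the ultrafilter. *)
Lemma ultra_limit (I : Type) (U : set_system I) (f : I -> R) :
  UltraFilter U -> (forall i, 0 <= f i <= 1) ->
  exists2 l : R, 0 <= l <= 1 & f @ U --> l.
Proof.
move=> UU f01; have fU : (f @ U) `[0, 1]%classic.
  suff : U (f @^-1` `[0, 1]%classic) by [].
  by apply: filterE => i; rewrite /= in_itv; exact: f01.
have [l [l01 lU]] := @segment_compact R 0 1 (f @ U) _ fU.
exists l; first by move: l01; rewrite /= in_itv.
move=> V Vl; rewrite nbhs_simpl /=.
have [//|UV] := in_ultra_setVsetC (f @^-1` V) UU.
by have [x [] //] := lU (~` V) V UV Vl.
Qed.

End UltraLimit.

(** For a subgroup H this is equivalent to the amenability of H; taking means on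
    the ambient group avoids turning H into a group type. *)
Definition left_invariant_mean (R : realType) (G : groupType) (H : set G) :=
  exists mu : set G -> R,
    [/\ forall A, 0 <= mu A,
        mu setT = 1,
        forall A B, A `&` B = set0 -> mu (A `|` B) = mu A + mu B
      & forall h A, H h -> mu [set (h * g)%g | g in A] = mu A].

Definition is_subgroup (G : groupType) (H : set G) :=
  [/\ H 1%g, forall g h, H g -> H h -> H (g * h)%g & forall g, H g -> H g^-1%g].

Section Mass.
Variables (R : realType) (G : groupType).
Implicit Types (u v w : l2 R G) (A B : set G) (g h s : G).

Lemma restr_l2 A v : (fun g => if g \in A then v g else 0) \in @l2_pred R G.
Proof.
rewrite /in_mem /= /l2_pred; apply: le_lt_trans (l2P v).
apply: sqnorm_le => g; case: ifP => // _; rewrite Normc.normc0 normc_ge0//.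
Qed.

Definition restr A v : l2 R G := L2 (restr_l2 A v).

Lemma restrE A v g : restr A v g = if g \in A then v g else 0.
Proof. by []. Qed.

Lemma restrB A u v : restr A (u - v) = restr A u - restr A v.
Proof.
by apply: l2_ext => g; rewrite l2B !restrE l2B; case: ifP; rewrite ?subr0.
Qed.

Lemma l2norm_mono u v : (forall g, Normc.normc (u g) <= Normc.normc (v g)) ->
  l2norm u <= l2norm v.
Proof.
move=> uv; rewrite -[leRHS]mul1r; apply: l2norm_le => //.
by rewrite expr1n mul1e; exact: sqnorm_le.
Qed.

Lemma l2norm_restr A v : l2norm (restr A v) <= l2norm v.
Proof.
apply: l2norm_mono => g; rewrite restrE; case: ifP => // _.
by rewrite Normc.normc0 normc_ge0.
Qed.

Lemma restrT v : restr setT v = v.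
Proof. by apply: l2_ext => g; rewrite restrE in_setT. Qed.

Lemma left_regular_restr s A v :
  left_regular s (restr A v) =
  restr [set (s * g)%g | g in A] (left_regular s v).
Proof.
apply: l2_ext => g; rewrite left_regularE !restrE left_regularE.
congr (if _ then _ else _); apply/idP/idP; rewrite !inE.
  by move=> As; exists (s^-1 * g)%g; rewrite ?mulVKg.
by move=> [h Ah <-]; rewrite mulKg.
Qed.

(** For a unit vector v, the finitely additive probability of density |v|^2. *)
Definition mass v A : R := l2norm (restr A v) ^+ 2.

Lemma massU v A B : A `&` B = set0 -> mass v (A `|` B) = mass v A + mass v B.
Proof.
move=> AB; apply: EFin_inj; rewrite EFinD !l2norm_sqr /sqnorm -esumD;
  try by move=> g _; rewrite lee_fin sqr_ge0.
apply: eq_esum => g _; rewrite -EFinD !restrE in_setU.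
case: (boolP (g \in A)) => gA; case: (boolP (g \in B)) => gB;
  rewrite ?orbT ?orbF ?(Normc.normc0, expr0n, addr0, add0r)//.
by have : (A `&` B) g; [split; rewrite -inE | rewrite AB].
Qed.

(** The square root of the mass of A is the norm of the restriction of v to A,
    so the triangle inequality suffices, and the two masses are squares of
    numbers in [0, 1]. *)
Lemma mass_translate v s A (e : R) : l2norm v = 1 ->
  l2norm (left_regular s v - v) <= e ->
  `|mass v [set (s * g)%g | g in A] - mass v A| <= 2 * e.
Proof.
move=> v1 ve; rewrite /mass subr_sqr normrM mulrC.
set B := [set _ | _ in A].
have B1 : l2norm (restr B v) <= 1 by rewrite -v1 l2norm_restr.
have A1 : l2norm (restr A v) <= 1 by rewrite -v1 l2norm_restr.
apply: ler_pM => //.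
  rewrite ger0_norm ?addr_ge0 ?l2norm_ge0//.
  by rewrite (_ : 2 = 1 + 1)// lerD.
have -> : l2norm (restr A v) = l2norm (restr B (left_regular s v)).
  by rewrite -left_regular_restr l2norm_left_regular.
apply: le_trans ve; set w := left_regular s v.
have dB : l2norm (restr B w - restr B v) <= l2norm (w - v).
  by rewrite -restrB l2norm_restr.
rewrite ler_norml; apply/andP; split.
  rewrite lerBrDl lerBlDr -lerBlDl; apply: le_trans dB.
  rewrite lerBlDr; apply: le_trans (l2normD _ _).
  by rewrite subrK.
rewrite lerBlDr; apply: le_trans (_ : l2norm (w - v) + _ <= _); last by [].
rewrite -[in leLHS](subrK (restr B w) (restr B v)).
apply: le_trans (l2normD _ _) _; rewrite lerD2r -l2normN opprB.
exact: dB.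
Qed.

Definition almost_invariant_vectors (H : set G) := forall (S : seq G) (e : R),
  (forall s, s \in S -> H s) -> 0 < e ->
  exists2 v, l2norm v = 1 &
             forall s, s \in S -> l2norm (left_regular s v - v) <= e.

(** Take the limit of the densities |v|^2 along an ultrafilter on pairs (S, n),
    where v is 1/(n+1)-invariant under the elements of S that belong to H; the
    ultrafilter refines the filter of all large pairs. *)
Lemma almost_invariant_mean (H : set G) :
  almost_invariant_vectors H -> left_invariant_mean R H.
Proof.
move=> aiv.
pose J := (seq G * nat)%type.
have /choice[V VP] : forall j : J, exists v, l2norm v = 1 /\
    forall s, s \in j.1 -> H s -> l2norm (left_regular s v - v) <= j.2.+1%:R^-1.
  move=> [S n]; have [] := aiv [seq s <- S | s \in H] n.+1%:R^-1.
  - by move=> s; rewrite mem_filter => /andP[/set_mem].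
  - by rewrite invr_gt0.
  move=> v v1 vS; exists v; split=> // s sS Hs; apply: vS.
  by rewrite mem_filter sS andbT; exact: mem_set.
pose base (j : J) := [set k : J | {subset j.1 <= k.1} /\ (j.2 <= k.2)%N].
have baseF : ProperFilter (filter_from [set: J] base).
  apply: filter_from_proper; last by move=> j _; exists j; split.
  apply: filter_from_filter; first by exists ([::], 0%N).
  move=> [S n] [S' n'] _ _; exists (S ++ S', maxn n n') => //=.
  move=> -[T m] [/= ST nm].
  move: nm; rewrite geq_max => /andP[nm n'm].
  by split; split=> //= s sS; apply: ST; rewrite mem_cat sS ?orbT.
have [U [UU bU]] := ultraFilterLemma baseF.
have mass01 A j : 0 <= mass (V j) A <= 1.
  rewrite sqr_ge0 expr_le1 ?l2norm_ge0//= -(VP j).1; exact: l2norm_restr.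
have /choice[mu muP] : forall A, exists l : R, 0 <= l <= 1 /\
    (fun j => mass (V j) A) @ U --> l.
  by move=> A; have [l] := ultra_limit UU (mass01 A); exists l.
exists mu; split.
- by move=> A; have [/andP[]] := muP A.
- have [_ cT] := muP setT; apply: cvg_unique cT _ => //.
  rewrite (_ : (fun j => _) = cst 1); first exact: cvg_cst.
  by apply/funext => j; rewrite /mass restrT (VP j).1 expr1n.
- move=> A B AB.
  have [[_ cA] [_ cB] [_ cAB]] := And3 (muP A) (muP B) (muP (A `|` B)).
  apply: cvg_unique cAB _ => //.
  rewrite (_ : (fun j => _) = (fun j => mass (V j) A + mass (V j) B)).
    exact: cvgD.
  by apply/funext => j; rewrite massU.
move=> h A Hh; set hA := [set _ | _ in A].
have [[_ cA] [_ chA]] := (muP A, muP hA).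
have cd : (fun j => mass (V j) hA - mass (V j) A) @ U --> mu hA - mu A.
  exact: cvgB.
apply/eqP; rewrite -subr_eq0; apply/eqP; apply: cvg_unique cd _ => //.
apply/cvgrPdist_le => e e0.
have [n ne] : exists n, n.+1%:R^-1 <= e / 2.
  have /cvgrPdist_le/(_ _ (divr_gt0 e0 (ltr0n R 2)))[n _ /(_ n (leqnn n))] :=
     @cvg_harmonic R.
  by rewrite /= sub0r normrN ger0_norm// => ?; exists n.
have := bU (base ([:: h], n)) ltac:(by exists ([:: h], n)).
apply: filterS => -[S m] [/= hS nm]; rewrite sub0r normrN.
have [v1 vS] := VP (S, m).
apply: le_trans (mass_translate _ v1 (vS h (hS _ (mem_head _ _)) Hh)) _.
rewrite mulrC -ler_pdivlMr//; apply: le_trans ne.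
by rewrite lef_pV2 ?posrE// ler_nat.
Qed.

End Mass.

(** * Spectral gap for subgroups without an invariant mean *)

Section Kesten.
Variables (R : realType) (G : groupType).
Implicit Types (u v w : l2 R G) (p q : seq G) (g h s t : G).

(** The operator norm of the sum of the lambda(s), s in p, is at most M. *)
Definition conv_bound p (M : R) := forall v,
  l2norm (\sum_(s <- p) left_regular s v) <= M * l2norm v.

Lemma conv_bound_ge0 p M : conv_bound p M -> 0 <= M.
Proof.
move=> /(_ (delta R 1%g)); rewrite l2norm_delta mulr1.
by apply: le_trans; exact: l2norm_ge0.
Qed.

Definition mul_seq p q : seq G := [seq (s * t)%g | s <- p, t <- q].

(** The sum over the product family is the composition of the two sums. *)
Lemma conv_bound_mul p q M N : conv_bound p M -> conv_bound q N ->
  conv_bound (mul_seq p q) (M * N).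
Proof.
move=> pM qN v; rewrite big_allpairs_dep /=.
have -> : \sum_(s <- p) \sum_(t <- q) left_regular (s * t)%g v =
    \sum_(s <- p) left_regular s (\sum_(t <- q) left_regular t v).
  apply: eq_bigr => s _; rewrite lin_sum; last exact: left_regular_linear.
  by apply: eq_bigr => t _; rewrite left_regularM.
apply: le_trans (pM _) _; rewrite -mulrA; apply: ler_wpM2l => //.
exact: conv_bound_ge0 pM.
Qed.

Lemma mul_seq_sub (H : set G) p q : is_subgroup H ->
  (forall s, s \in p -> H s) -> (forall s, s \in q -> H s) ->
  forall s, s \in mul_seq p q -> H s.
Proof.
by move=> [_ HM _] pH qH s /allpairsP[[x y] /= [xp yq ->]]; apply: HM; auto.
Qed.

(** Without an invariant mean there are a finite S and e > 0 such that every
    unit vector v is moved by more than e by some s in S.  By the parallelogram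
    identity |lambda(s) v + v| <= k with k = sqrt (4 - e^2) < 2, so in the sum
    over the family 1 :: S the terms of 1 and s lose 2 - k > 0 together. *)
Lemma nonamenable_gap (H : set G) : is_subgroup H ->
  ~ left_invariant_mean R H ->
  exists p, exists r : R, [/\ forall s, s \in p -> H s, 0 < (size p)%:R :> R,
    0 <= r < 1 & conv_bound p (r * (size p)%:R)].
Proof.
move=> [H1 _ _] noH.
have [S [e [SH e0 gap]]] : exists (S : seq G) (e : R),
    [/\ forall s, s \in S -> H s, 0 < e & forall v, l2norm v = 1 ->
     exists2 s, s \in S & e < l2norm (left_regular s v - v)].
  apply: contrapT => no; apply: noH; apply: almost_invariant_mean => S e SH e0.
  apply: contrapT => nov; apply: no; exists S, e; split=> // v v1.
  apply: contrapT => nos; apply: nov; exists v => // s sS.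
  by rewrite leNgt; apply/negP => lt; apply: nos; exists s.
pose k := Num.sqrt (4 - e ^+ 2).
have k2 : k < 2.
  have -> : 2 = Num.sqrt (2 ^+ 2) :> R by rewrite sqrtr_sqr ger0_norm.
  by rewrite ltr_sqrt ?exprn_gt0// -natrX ltrBlDr ltrDl exprn_gt0.
pose m : R := (size S)%:R.
have bnd v : l2norm v = 1 ->
    l2norm (\sum_(s <- 1%g :: S) left_regular s v) <= m - 1 + k.
  move=> v1; have [s sS es] := gap v v1.
  rewrite big_cons left_regular1 (perm_big _ (perm_to_rem sS)) big_cons addrA.
  apply: le_trans (l2normD _ _) _; rewrite [leLHS]addrC.
  apply: (@lerD R).
    apply: le_trans (l2norm_sum _ _ _) _.
    under eq_bigr do rewrite l2norm_left_regular v1.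
    rewrite big_const_seq count_predT iter_addr_0 size_rem//.
    rewrite /m; case: (S) sS => // x l _ /=.
    by rewrite -[in leRHS]natr1 addrK.
  have pl := parallelogram (left_regular s v) v.
  rewrite l2norm_left_regular v1 expr1n in pl.
  rewrite addrC -[leLHS]ger0_norm ?l2norm_ge0// -sqrtr_sqr ler_sqrt; last first.
    rewrite subr_ge0.
    have : e ^+ 2 <= l2norm (left_regular s v - v) ^+ 2.
      by rewrite ler_pXn2r ?nnegrE ?l2norm_ge0// ltW.
    have := sqr_ge0 (l2norm (left_regular s v + v)).
    lra.
  have : e ^+ 2 <= l2norm (left_regular s v - v) ^+ 2.
    by rewrite ler_pXn2r ?nnegrE ?l2norm_ge0// ltW.
  lra.
have mk0 : 0 <= m - 1 + k.
  by apply: le_trans (bnd _ (l2norm_delta R (1%g : G))); exact: l2norm_ge0.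
have m0 : 0 <= m by rewrite /m.
have sz : (size (1%g :: S))%:R = m + 1 :> R by rewrite /= -natr1.
exists (1%g :: S), ((m - 1 + k) / (m + 1)); split.
- by move=> s; rewrite inE => /predU1P[->//|/SH].
- by rewrite sz ltr_wpDl.
- apply/andP; split; first by rewrite divr_ge0// addr_ge0.
  by rewrite ltr_pdivrMr ?ltr_wpDl// mul1r; lra.
rewrite sz divfK ?gt_eqF ?ltr_wpDl// => v.
have [/l2norm_eq0 ->|v0] := eqVneq (l2norm v) 0.
  rewrite big1 ?l2norm0 ?mulr0// => s _.
  by rewrite lin0//; exact: left_regular_linear.
have [w w1 vw] := normalize_l2 v0.
rewrite {1}vw.
have -> : \sum_(s <- 1%g :: S) left_regular s ((l2norm v)%:C%C *: w) =
   (l2norm v)%:C%C *: \sum_(s <- 1%g :: S) left_regular s w.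
  rewrite scaler_sumr; apply: eq_bigr => s _; rewrite linZ//.
  exact: left_regular_linear.
apply: le_trans (l2normZ_le _ _) _.
rewrite normc_real ger0_norm ?l2norm_ge0// mulrC ler_wpM2r ?l2norm_ge0//.
exact: bnd.
Qed.

(** Iterating the gap over powers of the family drives the norm of the average
    to 0. *)
Lemma nonamenable_small_norm (H : set G) (e : R) : is_subgroup H ->
  ~ left_invariant_mean R H -> 0 < e ->
  exists p, [/\ forall s, s \in p -> H s, 0 < (size p)%:R :> R &
    conv_bound p (e * (size p)%:R)].
Proof.
move=> Hs noH e0.
have [p [r [pH p0 /andP[r0 r1] pr]]] := nonamenable_gap Hs noH.
have key n : exists q, [/\ forall s, s \in q -> H s, 0 < (size q)%:R :> R &
    conv_bound q (r ^+ n * (size q)%:R)].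
  elim: n => [|n [q [qH q0 qr]]].
    exists [:: 1%g]; split=> //.
      by move=> s; rewrite inE => /eqP ->; case: Hs.
    by move=> v; rewrite big_seq1 left_regular1 expr0 !mul1r.
  exists (mul_seq p q); split; first exact: mul_seq_sub.
    by rewrite size_allpairs natrM mulr_gt0.
  rewrite size_allpairs natrM exprS mulrACA.
  exact: conv_bound_mul.
have [|n rn] := @exprn_lt_exists _ r e _ e0; first exact/andP.
have [q [qH q0 qr]] := key n; exists q; split=> // v.
apply: le_trans (qr v) _; apply: ler_wpM2r; first exact: l2norm_ge0.
by apply: ler_wpM2r; [exact: ltW | exact: ltW].
Qed.

End Kesten.

(** * An absorption principle for twisted convolution sums *)

Section Fell.
Variables (R : realType) (G : groupType) (H K : set G).
Hypothesis subH : is_subgroup H.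
Hypothesis subK : is_subgroup K.
Hypothesis commHK : forall h k, H h -> K k -> (h * k = k * h)%g.
Hypothesis trivHK : forall g, H g -> K g -> g = 1%g.
Implicit Types (u v w : l2 R G) (p : seq G) (g h k s x y : G).

Let H1 : H 1%g. Proof. by case: subH. Qed.
Let HM g h : H g -> H h -> H (g * h)%g.
Proof. by case: subH => _ + _; apply. Qed.
Let HV g : H g -> H g^-1%g. Proof. by case: subH => _ _; apply. Qed.
Let K1 : K 1%g. Proof. by case: subK. Qed.
Let KM g h : K g -> K h -> K (g * h)%g.
Proof. by case: subK => _ + _; apply. Qed.
Let KV g : K g -> K g^-1%g. Proof. by case: subK => _ _; apply. Qed.

Definition double_orbit g : set G :=
  [set x | exists h k, [/\ H h, K k & x = (h * k * g)%g]].

Lemma double_orbit_mul g h k : H h -> K k ->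
  double_orbit (h * k * g)%g = double_orbit g.
Proof.
move=> Hh Kk; apply/seteqP; split=> x [h' [k' [Hh' Kk' ->]]].
  exists (h' * h)%g, (k' * k)%g; split; [exact: HM | exact: KM |].
  by rewrite !mulgA -(mulgA h' k' h) -(commHK Hh Kk') !mulgA.
exists (h' * h^-1)%g, (k' * k^-1)%g; split.
- by apply: HM => //; exact: HV.
- by apply: KM => //; exact: KV.
rewrite !mulgA -(mulgA _ k^-1%g h) -(commHK Hh (KV Kk)) !mulgA.
by rewrite -(mulgA _ k' h) -(commHK Hh Kk') !mulgA !mulgVK.
Qed.

Definition orbit_rep g := xget 1%g (double_orbit g).

Lemma orbit_repP g :
  exists h k, [/\ H h, K k & g = (h * k * orbit_rep g)%g].
Proof.
have [h [k [Hh Kk e]]] : double_orbit g (orbit_rep g).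
  apply: (xgetPex 1%g); exists g, 1%g, 1%g; split=> //.
  by rewrite !mul1g.
exists h^-1%g, k^-1%g; split; [exact: HV | exact: KV |].
by rewrite e (commHK Hh Kk) !mulgA mulgVK mulVg mul1g.
Qed.

Lemma orbit_rep_mul g h k : H h -> K k ->
  orbit_rep (h * k * g)%g = orbit_rep g.
Proof. by move=> Hh Kk; rewrite /orbit_rep double_orbit_mul. Qed.

(** A transversal for K acting by left translations which is moreover stable
    under H. *)
Definition transversal_K : set G :=
  [set y | exists2 h, H h & y = (h * orbit_rep y)%g].

Lemma transversal_decomp g :
  exists k y, [/\ K k, transversal_K y & g = (k * y)%g].
Proof.
have [h [k [Hh Kk e]]] := orbit_repP g.
exists k, (h * orbit_rep g)%g; split=> //; last first.
  by rewrite mulgA -(commHK Hh Kk).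
exists h => //; congr (h * _)%g.
have -> : (h * orbit_rep g = 1 * k^-1 * g)%g.
  by rewrite mul1g {2}e (commHK Hh Kk) !mulgA mulVg mul1g.
by rewrite orbit_rep_mul//; exact: KV.
Qed.

(** Uniqueness comes from the trivial intersection: k'^-1 k = h' h^-1 lies in
    both H and K. *)
Lemma transversal_uniq k k' y y' : K k -> K k' ->
  transversal_K y -> transversal_K y' -> (k * y = k' * y')%g ->
  k = k' /\ y = y'.
Proof.
move=> Kk Kk' [h Hh yh] [h' Hh' yh'] e.
have r : orbit_rep y = orbit_rep y'.
  rewrite -(orbit_rep_mul y H1 Kk) -(orbit_rep_mul y' H1 Kk').
  by rewrite !mul1g e.
have kk : k = k'.
  have ee : (k * h = k' * h')%g.
    by apply: (mulIg (orbit_rep y)); rewrite -!mulgA {2}r -yh -yh'.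
  have e2 : (k'^-1 * k = h' * h^-1)%g.
    by apply: (mulIg h); rewrite mulgVK -mulgA ee mulKg.
  have : (k'^-1 * k = 1)%g.
    apply: trivHK; last by apply: KM => //; exact: KV.
    by rewrite e2; apply: HM => //; exact: HV.
  by move=> kk; rewrite -(mulVKg k' k) kk mulg1.
by split=> //; move: e; rewrite kk => /mulgI.
Qed.

Lemma transversal_mul h y : H h -> transversal_K y -> transversal_K (h * y)%g.
Proof.
move=> Hh [h' Hh' e]; exists (h * h')%g; first exact: HM.
have := orbit_rep_mul y Hh K1; rewrite mulg1 => ->.
by rewrite -mulgA -e.
Qed.

Lemma right_translate_l2 y v : (fun g => v (g * y)%g) \in @l2_pred R G.
Proof.
have := l2P v; rewrite /in_mem /= /l2_pred; congr (_ < _)%E.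
rewrite /sqnorm (reindex_esum setT setT (fun g => g * y)%g)//.
split=> // [h1 h2 _ _|h _]; first exact: mulIg.
by exists (h * y^-1)%g => //; rewrite mulgVK.
Qed.

(** The restriction of v to the coset K y, read as a function on K. *)
Definition slice y v : l2 R G := restr K (L2 (right_translate_l2 y v)).

Lemma sliceE y v k : slice y v k = if k \in K then v (k * y)%g else 0.
Proof. by []. Qed.

Lemma slice_sum (T : Type) (r : seq T) (F : T -> l2 R G) y :
  slice y (\sum_(i <- r) F i) = \sum_(i <- r) slice y (F i).
Proof.
apply: l2_ext => k; rewrite sliceE !l2sum_val.
case: ifPn => kK; first by apply: eq_bigr => i _; rewrite sliceE kK.
by rewrite big1// => i _; rewrite sliceE (negbTE kK).
Qed.

Lemma sqnorm_slices v :
  sqnorm v = (\esum_(y in transversal_K) sqnorm (slice y v))%E.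
Proof.
have -> : (\esum_(y in transversal_K) sqnorm (slice y v) =
    \esum_(y in transversal_K) \esum_(k in K)
      ((Normc.normc (v (k * y)%g)) ^+ 2)%:E)%E.
  apply: eq_esum => y _; rewrite [RHS]esum_mkcond; apply: eq_esum => k _.
  by rewrite sliceE; case: ifP => // _; rewrite Normc.normc0 expr0n.
rewrite esum_esum; last by move=> *; rewrite lee_fin sqr_ge0.
rewrite /sqnorm (reindex_esum (transversal_K `*`` (fun=> K)) setT
   (fun z => z.2 * z.1)%g)//.
split=> //= [[y k] [y' k']|g _].
  rewrite !inE /= => -[Yy Kk] [Yy' Kk'] e.
  by have [-> ->] := transversal_uniq Kk Kk' Yy Yy' e.
by have [k [y [Kk Yy ->]]] := transversal_decomp g; exists (y, k).
Qed.

(** Replacing v by the norms of its slices along the cosets of K keeps the norm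
    of v and forgets everything that the elements of K can see. *)
Definition slice_norms v : G -> R[i] := fun y =>
  if y \in transversal_K then (l2norm (slice y v))%:C%C else 0.

Lemma sqnorm_slice_norms v : sqnorm (slice_norms v) = sqnorm v.
Proof.
rewrite [RHS]sqnorm_slices [RHS]esum_mkcond; apply: eq_esum => y _.
rewrite /slice_norms; case: ifP => _; last by rewrite Normc.normc0 expr0n.
by rewrite normc_real ger0_norm ?l2norm_ge0// l2norm_sqr.
Qed.

Lemma slice_norms_l2 v : slice_norms v \in @l2_pred R G.
Proof. by rewrite /in_mem /= /l2_pred sqnorm_slice_norms; exact: l2P. Qed.

Lemma slice_twisted s k y v : H s -> K k ->
  slice y (left_regular (s * k)%g v) = left_regular k (slice (s^-1 * y)%g v).
Proof.
move=> Hs Kk; apply: l2_ext => g; rewrite left_regularE !sliceE left_regularE.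
have -> : (k^-1 * g)%g \in K = (g \in K).
  apply/idP/idP; rewrite !inE => Kg; last by apply: KM => //; exact: KV.
  by rewrite -(mulVKg k g); exact: KM.
case: ifP => //; rewrite inE => Kg; congr (v _).
by rewrite invgM -!mulgA; congr (_ * _)%g; rewrite !mulgA (commHK (HV Hs) Kg).
Qed.

(** Let F be the function of slice norms of v.  By the triangle inequality the
    slice norms of the twisted sum applied to v are dominated by the plain sum
    of the lambda(s) applied to F, for an arbitrary map phi into K: each phi s
    acts isometrically inside the slices. *)
Lemma fell_bound p (phi : G -> G) (M : R) :
  (forall s, s \in p -> H s) -> (forall s, H s -> K (phi s)) ->
  conv_bound p M -> forall v,
  l2norm (\sum_(s <- p) left_regular (s * phi s)%g v) <= M * l2norm v.
Proof.
move=> pH phiK pM v; set W := \sum_(_ <- _) _.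
pose F : l2 R G := L2 (slice_norms_l2 v).
have Fv : sqnorm F = sqnorm v by exact: sqnorm_slice_norms.
apply: l2norm_le; first exact: conv_bound_ge0 pM.
set W' := \sum_(s <- p) left_regular s F.
apply: (@le_trans _ _ (sqnorm W')); last first.
  rewrite -Fv -!l2norm_sqr -EFinM lee_fin -exprMn.
  have MF : 0 <= M * l2norm F.
    by rewrite mulr_ge0 ?l2norm_ge0//; exact: conv_bound_ge0 pM.
  by rewrite ler_pXn2r ?nnegrE ?l2norm_ge0//; exact: pM.
rewrite sqnorm_slices esum_mkcond; apply: le_esum => y _.
case: ifPn => [|_]; last by rewrite lee_fin sqr_ge0.
rewrite inE => Yy; rewrite -l2norm_sqr lee_fin.
rewrite ler_pXn2r ?nnegrE ?l2norm_ge0 ?normc_ge0//.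
rewrite /W slice_sum; apply: le_trans (l2norm_sum _ _ _) _.
have -> : W' y = (\sum_(s <- p) l2norm (slice (s^-1 * y)%g v))%:C%C.
  rewrite l2sum_val rmorph_sum !big_seq; apply: eq_bigr => s /pH Hs.
  rewrite left_regularE /F /= /slice_norms ifT//; apply/mem_set.
  by apply: transversal_mul => //; exact: HV.
rewrite normc_real ger0_norm; last by apply: sumr_ge0 => s _; exact: l2norm_ge0.
rewrite !big_seq; apply: ler_sum => s /pH Hs.
by rewrite slice_twisted ?l2norm_left_regular//; exact: phiK.
Qed.

End Fell.

(** * Extending a partially invariant mean *)

(** Pick a representative r of each right coset of H and send h r to h: this is
    an H-equivariant map from G to H, along which means are pushed. *)
Lemma coset_section (G : groupType) (H : set G) : is_subgroup H ->
  exists pi : G -> G, (forall g, H (pi g)) /\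
    (forall h g, H h -> pi (h * g)%g = (h * pi g)%g).
Proof.
move=> [H1 HM HV].
pose coset g := [set x | exists2 h, H h & x = (h * g)%g].
pose rep g := xget 1%g (coset g).
have cosetM h g : H h -> coset (h * g)%g = coset g.
  move=> Hh; apply/seteqP; split=> x [h' Hh' ->].
    by exists (h' * h)%g; [exact: HM | rewrite mulgA].
  exists (h' * h^-1)%g; first by apply: HM => //; exact: HV.
  by rewrite mulgA mulgVK.
exists (fun g => g * (rep g)^-1)%g; split=> [g|h g Hh]; last first.
  by rewrite /rep cosetM// mulgA.
have [h Hh ->] : coset g (rep g).
  by apply: (xgetPex 1%g); exists g, 1%g => //; rewrite mul1g.
by rewrite invgM mulgA mulgV mul1g; exact: HV.
Qed.

Section FinitelyAdditive.
Variables (R : realType) (T : Type) (m : set T -> R).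
Hypothesis m0 : forall A, 0 <= m A.
Hypothesis mU : forall A B, A `&` B = set0 -> m (A `|` B) = m A + m B.

Lemma fadd_set0 : m set0 = 0.
Proof.
have := mU (set0I set0); rewrite setU0 => e.
by apply: (addrI (m set0)); rewrite addr0 -e.
Qed.

Lemma fadd_split A B : m A = m (A `&` B) + m (A `&` ~` B).
Proof. by rewrite -mU ?setUIDK// setIACA setICr setI0. Qed.

Lemma fadd_mono A B : A `<=` B -> m A <= m B.
Proof.
by move=> AB; rewrite (fadd_split B A) (setIidr AB) lerDl m0.
Qed.

Lemma fadd_partition (L : eqType) (theta : T -> L) (s : seq L) A :
  uniq s -> (forall x, A x -> theta x \in s) ->
  m A = \sum_(l <- s) m (A `&` [set x | theta x = l]).
Proof.
elim: s A => [|l s IH] A /=.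
  move=> _ As; rewrite big_nil -fadd_set0; congr m.
  by apply/seteqP; split=> x // /As.
move=> /andP[ls us] As; rewrite big_cons (fadd_split A [set x | theta x = l]).
congr (_ + _); rewrite (IH _ us); last first.
  by move=> x [/As + ntl]; rewrite inE => /predU1P[tl|//]; case: ntl.
rewrite !big_seq; apply: eq_bigr => k ks; congr m.
apply/seteqP; split=> x; first by move=> [[Ax _] tx]; split.
move=> [Ax tx]; split=> //; split=> //= tl.
by move: ls; rewrite -tl tx ks.
Qed.

End FinitelyAdditive.

Definition translate (G : groupType) (g : G) (A : set G) : set G :=
  [set x | A (g^-1 * x)%g].

Lemma translateE (G : groupType) (g : G) (A : set G) :
  [set (g * h)%g | h in A] = translate g A.
Proof.
apply/seteqP; split=> x; first by move=> [h Ah <-]; rewrite /translate /= mulKg.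
by move=> Ax; exists (g^-1 * x)%g => //; rewrite mulVKg.
Qed.

(** In this section m gives D mass 1 and is invariant under the left translations
    that stay inside D, and theta g is one of finitely many elements that bring
    g into D.  Cutting a set according to the value of theta and bringing each
    part into D defines M, which turns out to be invariant under all
    translations. *)
Section ExtendMean.
Variables (R : realType) (G : groupType) (m : set G -> R) (D : set G).
Hypothesis m0 : forall A, 0 <= m A.
Hypothesis mU : forall A B, A `&` B = set0 -> m (A `|` B) = m A + m B.
Hypothesis mD : m D = 1.
Hypothesis m_translate : forall g A, A `<=` D -> translate g A `<=` D ->
  m (translate g A) = m A.
Variables (s : seq G) (theta : G -> G).
Hypothesis theta_s : forall g, theta g \in s.
Hypothesis thetaD : forall g, D (theta g * g)%g.

Let L := undup s.
Let uL : uniq L. Proof. exact: undup_uniq. Qed.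
Let tL g : theta g \in L. Proof. by rewrite mem_undup. Qed.

Let M A := \sum_(l <- L) m (translate l (A `&` [set g | theta g = l])).

Let M_ge0 A : 0 <= M A.
Proof. by apply: sumr_ge0. Qed.

Let MU A B : A `&` B = set0 -> M (A `|` B) = M A + M B.
Proof.
move=> AB; rewrite /M -big_split /=; apply: eq_bigr => l _.
rewrite -mU; last first.
  apply/seteqP; split=> // x [[Ax _] [Bx _]].
  by have : (A `&` B) (l^-1 * x)%g by []; rewrite AB.
by congr m; rewrite setIUl.
Qed.

(** Cut further, according to the value k of theta before translation by g and
   its value l after: the (k, l) pieces of both sides correspond under the
   translation by l g k^-1, which stays inside D. *)
Let M_translate g A : M (translate g A) = M A.
Proof.
have E l : m (translate l (translate g A `&` [set x | theta x = l])) =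
    \sum_(k <- L) m (translate l (translate g A `&` [set x | theta x = l]) `&`
        [set x | theta (g^-1 * (l^-1 * x))%g = k]).
  by apply: fadd_partition.
have E' k : m (translate k (A `&` [set x | theta x = k])) =
    \sum_(l <- L) m (translate k (A `&` [set x | theta x = k]) `&`
        [set x | theta (g * (k^-1 * x))%g = l]).
  by apply: fadd_partition.
rewrite /M; under eq_bigr do rewrite E; under [RHS]eq_bigr do rewrite E'.
rewrite exchange_big /=; apply: eq_bigr => k _; apply: eq_bigr => l _.
set P := _ `&` _; set Q := _ `&` _.
have PQ : P = translate (l * g * k^-1)%g Q.
  have y1 x : (k^-1 * ((l * g * k^-1)^-1 * x) = g^-1 * (l^-1 * x))%g.
    by rewrite !invgM invgK -!mulgA mulKg.
  have y2 x : (g * (k^-1 * ((l * g * k^-1)^-1 * x)) = l^-1 * x)%g.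
    by rewrite y1 mulVKg.
  rewrite /P /Q /translate; apply/seteqP; split=> x /=; rewrite y2 y1.
    by move=> [[Ax tx] tk].
  by move=> [[Ax tx] tk].
rewrite PQ; apply: m_translate; last rewrite -PQ.
  move=> x [[_ /= tx] _]; have := thetaD (k^-1 * x)%g.
  by rewrite tx mulVKg.
move=> x [[_ /= tx] _]; have := thetaD (l^-1 * x)%g.
by rewrite tx mulVKg.
Qed.

(** M has total mass at least m D = 1, so it can be normalized. *)
Lemma extend_mean : amenable R G.
Proof.
have M1 : 1 <= M setT.
  rewrite -mD (fadd_partition mU uL (fun x _ => tL x)).
  apply: ler_sum => l _.
  rewrite -(@m_translate l); last 2 first.
  - by move=> x [].
  - move=> x [_ /= tx]; have := thetaD (l^-1 * x)%g.
    by rewrite tx mulVKg.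
  by apply: (fadd_mono m0 mU) => x [_ tx].
have Mp : 0 < M setT by apply: lt_le_trans M1.
exists (fun A => M A / M setT); split.
- by move=> A; rewrite divr_ge0.
- by rewrite divff// gt_eqF.
- by move=> A B AB; rewrite MU// mulrDl.
- by move=> g A; rewrite translateE M_translate.
Qed.

End ExtendMean.

(** * Zero-dimensional spaces, rigid stabilizers and swaps *)

Section Stone.
Variable X : topologicalType.
Implicit Types (A B O U V W : set X).

Lemma clopen_preimage (Y : topologicalType) (f : X -> Y) (U : set Y) :
  continuous f -> clopen U -> clopen (f @^-1` U).
Proof.
move=> /continuousP cf [oU cU]; split; first exact: cf.
by rewrite -openC preimage_setC; apply: cf; rewrite openC.
Qed.

Lemma clopenD U V : clopen U -> clopen V -> clopen (U `\` V).
Proof.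
by move=> cU cV; rewrite setDE; apply: clopenI => //; exact: clopenC.
Qed.

(** The filter of all large finite sequences of points of A turns the near
    covering form of compactness into the extraction of a finite subcover. *)
Lemma compact_seq_cover A (W : X -> set X) : compact A ->
  (forall x, A x -> open (W x) /\ W x x) ->
  exists s : seq X, (forall x, x \in s -> A x) /\
    forall y, A y -> exists2 x, x \in s & W x y.
Proof.
move=> /compact_near_coveringP cA AW.
pose inA := [set s : seq X | forall x, x \in s -> A x].
pose F := filter_from inA (fun s => [set t : seq X | {subset s <= t}]).
have FF : Filter F.
  apply: filter_from_filter; first by exists [::].
  move=> s t As At; exists (s ++ t).
    by move=> x; rewrite mem_cat => /orP[/As|/At].
  by move=> r str; split=> x xs; apply: str; rewrite mem_cat xs ?orbT.
have [|s As sW] := cA _ F (fun s y => exists2 x, x \in s & W x y) FF.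
  move=> x Ax; have [oW Wx] := AW x Ax.
  exists (W x, [set t : seq X | x \in t]) => /=; last first.
    by move=> [y t] [/= Wy xt]; exists x.
  split; first exact: open_nbhs_nbhs.
  exists [:: x] => [y|t xt]; first by rewrite inE => /eqP ->.
  by apply: xt; exact: mem_head.
by exists s; split=> // y Ay; apply: (sW s).
Qed.

(** Removing one point from a nonempty open set leaves a nonempty open set,
    because no singleton is open. *)
Lemma open_avoid (E : seq X) O : zero_dimensional X ->
  (forall x : X, ~ open [set x]) -> open O -> O !=set0 ->
  exists2 x, O x & x \notin E.
Proof.
move=> zd iso; elim: E O => [|e E IH] O oO [x Ox]; first by exists x.
have [||y [Oy ye] yE] := IH (O `\ e).
- rewrite openE => y [Oy /eqP /zd[U [[oU _] Uy Ue]]].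
  rewrite /interior; have /filterI := open_nbhs_nbhs (conj oO Oy).
  move=> /(_ _ (open_nbhs_nbhs (conj oU Uy))); apply: filterS => z [Oz Uz].
  by split=> // ze; apply: Ue; rewrite -ze.
- apply: contrapT => no; apply: (iso e).
  suff <- : O = [set e] by [].
  have Oe y : O y -> y = e.
    by move=> Oy; apply: contrapT => ye; apply: no; exists y.
  apply/seteqP; split=> y; first exact: Oe.
  by move=> ->; rewrite -(Oe _ Ox).
by exists y => //; rewrite inE negb_or yE andbT; apply/eqP.
Qed.

Lemma displaced_clopen (f : X -> X) x : zero_dimensional X -> continuous f ->
  f x <> x -> exists U, [/\ clopen U, U x & forall y, U y -> ~ U (f y)].
Proof.
move=> zd cf fx; have [|U [cU Ux Ufx]] := zd x (f x).
  by apply/eqP => e; apply: fx.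
exists (U `\` (f @^-1` U)); split=> //.
  by apply: clopenD => //; exact: clopen_preimage.
by move=> y [_ Ufy] [].
Qed.

Lemma cantor_set_stone : is_cantor_set X ->
  [/\ compact [set: X], zero_dimensional X & forall x : X, ~ open [set x]].
Proof.
move=> [f [cf [g [cg fg gf]]]].
have [perf cK hK zK] := cantor_like_cantor_space.
split.
- have -> : [set: X] = g @` setT.
    by apply/seteqP; split=> // x _; exists (f x).
  apply: continuous_compact => //.
  exact: continuous_subspaceT.
- move=> x y xy; have [|U [cU Ux Uy]] := zK (f x) (f y).
    by apply: contra_neq xy => /(can_inj fg).
  by exists (f @^-1` U); split=> //; exact: clopen_preimage.
move=> x ox; apply: ((perfectTP.1 perf) (f x)).
have -> : [set f x] = g @^-1` [set x].
  apply/seteqP; split=> y /=; first by move=> ->.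
  by move=> <-; rewrite gf.
by move/continuousP: cg; apply.
Qed.

End Stone.

Section FullGroup.
Variables (Gamma : groupType) (X : topologicalType) (a : homeo_action Gamma X).
Local Notation G := (full_group a).
Implicit Types (f g h : G) (c d : Gamma) (U V W : set X).

Lemma actM c d (x : X) : a (c * d)%g x = a c (a d x).
Proof. by rewrite gmulfM homeoME. Qed.

Lemma act1 (x : X) : a 1%g x = x.
Proof. by rewrite gmulf1. Qed.

Lemma actK c (x : X) : a c^-1%g (a c x) = x.
Proof. by rewrite -actM mulVg act1. Qed.

Lemma actKV c (x : X) : a c (a c^-1%g x) = x.
Proof. by rewrite -actM mulgV act1. Qed.

Lemma homeo_continuous (h : homeo X) : continuous h.
Proof. exact: (homeoP h).1. Qed.

Lemma full_groupM f g (x : X) : (f * g)%g x = f (g x).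
Proof. by []. Qed.

Lemma full_group1 (x : X) : (1%g : G) x = x.
Proof. by []. Qed.

Lemma full_groupK f (x : X) : f^-1%g (f x) = x.
Proof. by rewrite -full_groupM mulVg. Qed.

Lemma full_groupKV f (x : X) : f (f^-1%g x) = x.
Proof. by rewrite -full_groupM mulgV. Qed.

Lemma full_group_inj f : injective f.
Proof. exact: can_inj (full_groupK f). Qed.

Lemma full_group_ext f g : (forall x : X, f x = g x) -> f = g.
Proof. by move=> fg; apply/val_inj/homeo_ext. Qed.

Lemma full_group_orbit f (x : X) : exists c, f x = a c x.
Proof.
have /asboolP/(_ x)[c near_c] := full_groupP f.
by exists c; exact: nbhs_singleton near_c.
Qed.

Definition rigid_stabilizer U : set G := [set f | forall x, ~ U x -> f x = x].

Lemma rigid_stabilizer_subgroup U : is_subgroup (rigid_stabilizer U).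
Proof.
split=> [x _ //|g h gU hU x Ux|g gU x Ux].
  by rewrite full_groupM hU// gU.
by rewrite -[in LHS](gU x Ux) full_groupK.
Qed.

Lemma rigid_stabilizer_sub U V : U `<=` V ->
  rigid_stabilizer U `<=` rigid_stabilizer V.
Proof. by move=> UV f fU x Vx; apply: fU => /UV. Qed.

Lemma rigid_stabilizer_preserves U f (x : X) :
  rigid_stabilizer U f -> U x -> U (f x).
Proof.
move=> fU Ux; apply: contrapT => Ufx; have := fU _ Ufx.
by move=> /full_group_inj fxx; apply: Ufx; rewrite fxx.
Qed.

Lemma rigid_stabilizer_comm U V f g : U `&` V = set0 ->
  rigid_stabilizer U f -> rigid_stabilizer V g -> (f * g = g * f)%g.
Proof.
move=> UV fU gV; apply: full_group_ext => x; rewrite !full_groupM.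
have [Ux|nUx] := pselect (U x).
  have nV y : U y -> ~ V y.
    by move=> Uy Vy; have : (U `&` V) y by []; rewrite UV.
  rewrite (gV x (nV _ Ux)) (gV (f x))//; apply: nV.
  exact: rigid_stabilizer_preserves.
rewrite (fU x nUx).
have [Vx|nVx] := pselect (V x); last by rewrite (gV x nVx) fU.
apply: fU => Ugx; have : (U `&` V) (g x); last by rewrite UV.
by split=> //; exact: rigid_stabilizer_preserves.
Qed.

Lemma rigid_stabilizer_trivial U V f : U `&` V = set0 ->
  rigid_stabilizer U f -> rigid_stabilizer V f -> f = 1%g.
Proof.
move=> UV fU fV; apply: full_group_ext => x; rewrite full_group1.
have [Ux|/fU//] := pselect (U x); apply: fV => Vx.
by have : (U `&` V) x by []; rewrite UV.
Qed.

Lemma locally_in_continuous (f : X -> X) :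
  (forall x : X, exists c, \forall y \near x, f y = a c y) -> continuous f.
Proof.
move=> fa x V; have [c fc] := fa x.
rewrite (nbhs_singleton fc) => nV.
have aV : nbhs x (a c @^-1` V) := homeo_continuous nV.
change (nbhs x (f @^-1` V)).
by apply: filterS2 fc aV => y; rewrite /preimage /= => ->.
Qed.

(** When W and c W are disjoint, this is the involution that exchanges them
    through c and fixes all other points. *)
Definition swap_fun c W (x : X) : X :=
  if `[< W x >] then a c x else if `[< W (a c^-1%g x) >] then a c^-1%g x else x.

Lemma swap_fun_locally c W : clopen W ->
  forall x : X, exists d, \forall y \near x, swap_fun c W y = a d y.
Proof.
move=> cW x; pose W' := a c^-1%g @^-1` W.
have cW' : clopen W' by apply: clopen_preimage => //; exact: homeo_continuous.
have nearU (U : set X) : clopen U -> U x -> nbhs x U.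
  by move=> [oU _] Ux; apply: open_nbhs_nbhs.
have [Wx|nWx] := pselect (W x).
  exists c; have := nearU _ cW Wx; apply: filterS => y Wy.
  by rewrite /swap_fun asboolT.
have nW := nearU _ (clopenC W cW) nWx.
have [W'x|nW'x] := pselect (W' x).
  exists c^-1%g; apply: filterS2 nW (nearU _ cW' W'x) => y Wy W'y.
  by rewrite /swap_fun asboolF// asboolT.
exists 1%g; apply: filterS2 nW (nearU _ (clopenC W cW') nW'x) => y Wy W'y.
by rewrite /swap_fun !asboolF// act1.
Qed.

Lemma swap_exists c W : clopen W -> (forall x, W x -> ~ W (a c x)) ->
  exists f, (forall x, W x -> f x = a c x) /\
            (forall x, ~ W x -> ~ W (a c^-1%g x) -> f x = x).
Proof.
move=> cW disj; set f := swap_fun c W.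
have fa := swap_fun_locally c cW.
have cf : continuous f by exact: locally_in_continuous.
have fK x : f (f x) = x.
  rewrite {2}/f /swap_fun; case: asboolP => Wx.
    by rewrite /f /swap_fun asboolF ?actK ?asboolT//; exact: disj.
  case: asboolP => W'x; first by rewrite /f /swap_fun asboolT// actKV.
  by rewrite /f /swap_fun !asboolF.
have fh : homeomorphism f by split=> //; exists f.
have fP : Homeo (asboolT fh) \in full_group_pred a.
  by apply/asboolP => x; exact: fa.
exists (FullGroup fP); split=> x Wx /=; first by rewrite /f /swap_fun asboolT.
by move=> W'x; rewrite /f /swap_fun !asboolF.
Qed.

End FullGroup.

(** * Rigid stabilizers inherit non-amenability *)

Section RigidStabilizerMean.
Variables (R : realType) (Gamma : groupType) (X : topologicalType).
Variable a : homeo_action Gamma X.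
Hypothesis cX : compact [set: X].
Hypothesis zdX : zero_dimensional X.
Hypothesis freea : free_action a.
Hypothesis mina : minimal_action a.
Local Notation G := (full_group a).
Implicit Types (c d : Gamma) (U V W : set X) (A B : set Gamma).

Lemma free_act1 c (x : X) : a c x = x -> c = 1%g.
Proof.
by move=> cx; have : point_stabilizer a x c by []; rewrite freea.
Qed.

Lemma free_act_inj c d (x : X) : a c x = a d x -> c = d.
Proof.
move=> cd; have : (d^-1 * c)%g = 1%g.
  by apply: (@free_act1 _ x); rewrite actM cd actK.
by move=> dc; rewrite -(mulVKg d c) dc mulg1.
Qed.

(** By minimality the translates of U cover X; compactness leaves finitely
    many. *)
Lemma minimal_return U : open U -> U !=set0 ->
  exists s : seq Gamma, forall x : X, exists2 c, c \in s & U (a c x).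
Proof.
move=> oU U0.
have /choice[r rP] : forall x : X, exists c, U (a c x).
  move=> x; have [y [Uy [c _ cx]]] := mina x U0 oU.
  by exists c; rewrite cx.
have [x _|t [_ tP]] := @compact_seq_cover X setT (fun x => a (r x) @^-1` U) cX.
  split=> //; have /continuousP := @homeo_continuous X (a (r x)).
  exact.
exists (map r t) => x; have [y yt Uy] := tP x I.
by exists (r y) => //; exact: map_f.
Qed.

(** Push the mean to Gamma through an equivariant map from G to the rigid
    stabilizer followed by the orbit map at a point x0 of U, the orbit of x0
    being identified with Gamma by freeness.  The result m lives on the set D of
    return times of x0 to U and satisfies the hypotheses of [extend_mean]. *)
Lemma rigid_stabilizer_mean U : clopen U -> U !=set0 ->
  left_invariant_mean R (@rigid_stabilizer _ _ a U) -> amenable R Gamma.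
Proof.
move=> cU [x0 Ux0] [mu [mu0 mu1 muU muH]].
have [pi [piH piM]] := coset_section (@rigid_stabilizer_subgroup _ _ a U).
have /choice[c cE] : forall g : G, exists d, pi g x0 = a d x0.
  by move=> g; exact: full_group_orbit.
pose D := [set d | U (a d x0)].
pose m A := mu [set g | A (c g)].
have m0 A : 0 <= m A by exact: mu0.
have mU A B : A `&` B = set0 -> m (A `|` B) = m A + m B.
  move=> AB; rewrite /m -muU//; apply/seteqP; split=> // g [/= Ag Bg].
  by have : (A `&` B) (c g) by []; rewrite AB.
have mD : m D = 1.
  rewrite -mu1; congr mu; apply/seteqP; split=> // g _ /=.
  by rewrite /D /= -cE; exact: rigid_stabilizer_preserves.
(* On a clopen piece W displaced by d, the element d agrees with the swap of W
   and d W, which belongs to the rigid stabilizer of U. *)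
have m_local d W A : clopen W -> (forall x, W x -> ~ W (a d x)) ->
    W `<=` U -> (forall x, W x -> U (a d x)) ->
    (forall k, A k -> W (a k x0)) -> m (translate d A) = m A.
  move=> cW disj WU dWU AW.
  have [h [hW hN]] := swap_exists cW disj.
  have hU : rigid_stabilizer U h.
    move=> x nUx; apply: hN => [/WU//|Wd]; apply: nUx.
    by rewrite -(actKV a d x); exact: dWU.
  rewrite /m -(muH h [set g | A (c g)] hU); congr mu.
  apply/seteqP; split=> g; rewrite /translate /=.
    move=> Ag; exists (h^-1 * g)%g; last by rewrite mulVKg.
    suff -> : c (h^-1 * g)%g = (d^-1 * c g)%g by [].
    apply: (@free_act_inj _ _ x0); rewrite -cE piM; last first.
      by have [_ _] := @rigid_stabilizer_subgroup _ _ a U; apply.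
    rewrite full_groupM; apply: (@full_group_inj _ _ _ h).
    rewrite full_groupKV hW; last exact: AW.
    by rewrite -actM mulVKg cE.
  move=> [g' Ag' <-].
  suff -> : c (h * g')%g = (d * c g')%g by rewrite mulKg.
  apply: (@free_act_inj _ _ x0); rewrite -cE piM// full_groupM cE.
  by rewrite hW ?actM//; exact: AW.
have m_translate d A : A `<=` D -> translate d A `<=` D ->
    m (translate d A) = m A.
  move=> AD dAD; have [->|d1] := eqVneq d 1%g.
    by congr m; apply/seteqP; split=> k; rewrite /translate /= invg1 mul1g.
  (* By freeness the nontrivial d displaces a clopen neighbourhood of each point
     of V; finitely many of them cover V, and A is cut along them one by one. *)
  pose V := U `&` (a d @^-1` U).
  have cV : clopen V.
    apply: clopenI => //; apply: clopen_preimage => //.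
    exact: homeo_continuous.
  have /choice[W WP] : forall x, exists W, V x ->
      [/\ clopen W, W x, W `<=` V & forall y, W y -> ~ W (a d y)].
    move=> x; have [||W [cW Wx Wd]] := @displaced_clopen X (a d) x zdX.
    - exact: homeo_continuous.
    - by move=> /free_act1/eqP; rewrite (negbTE d1).
    exists (W `&` V) => Vx; split=> //; first exact: clopenI.
    by move=> y [Wy _] [Wdy _]; exact: (Wd y).
  have [||s [sV sW]] := @compact_seq_cover X V W.
  - by apply: (subclosed_compact _ cX) => //; exact: cV.2.
  - by move=> x /WP[[]].
  have {sW AD dAD}AW k : A k -> exists2 x, x \in s & W x (a k x0).
    move=> Ak; apply: sW; split; first exact: AD.
    rewrite /preimage /= -actM; apply: dAD.
    by rewrite /translate /= mulKg.

  elim: s sV A AW => [|x s IH] sV A AW.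
    have -> : A = set0 by apply/seteqP; split=> // k /AW[].
    by [].
  have [cW Wx WV Wd] := WP x (sV x (mem_head _ _)).
  pose B := [set k | W x (a k x0)].
  rewrite (fadd_split mU A B) (fadd_split mU (translate d A) (translate d B)).
  congr (_ + _).
    apply: (@m_local d (W x) (A `&` B)) => //.
    - by move=> y /WV[].
    - by move=> y /WV[].
    - by move=> k [].
  apply: (IH _ (A `&` ~` B)).
    by move=> y ys; apply: sV; rewrite inE ys orbT.
  move=> k [/AW[y]]; rewrite inE => /predU1P[->//|ys] Wy _.
  by exists y.
have [s sP] := minimal_return cU.1 (ex_intro _ _ Ux0).
have /choice[theta thP] : forall k, exists t, t \in s /\ D (t * k)%g.
  by move=> k; have [t ts Ut] := sP (a k x0); exists t; rewrite /D /= actM.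
apply: (@extend_mean _ _ m D m0 mU mD m_translate s theta) => k.
  exact: (thP k).1.
exact: (thP k).2.
Qed.

End RigidStabilizerMean.

(** * Powers averaging in the topological full group *)

Section ConjugateAverages.
Variables (R : realType) (G : groupType).
Implicit Types (v : l2 R G) (p q : seq G) (s t r : G).

Definition conj_bound p t (M : R) := forall v,
  l2norm (\sum_(s <- p) left_regular (s * t * s^-1)%g v) <= M * l2norm v.

(** Averaging further conjugates never increases the norm. *)
Lemma conj_bound_mull q p t M : conj_bound p t M ->
  conj_bound (mul_seq q p) t ((size q)%:R * M).
Proof.
move=> pM v; rewrite big_allpairs_dep /=.
have -> : \sum_(s <- q) \sum_(r <- p)
      left_regular (s * r * t * (s * r)^-1)%g v =
    \sum_(s <- q) left_regular s
      (\sum_(r <- p) left_regular (r * t * r^-1)%g (left_regular s^-1%g v)).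
  apply: eq_bigr => s _; rewrite lin_sum; last exact: left_regular_linear.
  by apply: eq_bigr => r _; rewrite -!left_regularM invgM !mulgA.
apply: le_trans (l2norm_sum _ _ _) _.
apply: (@le_trans _ _ (\sum_(s <- q) M * l2norm v)).
  apply: ler_sum => s _; rewrite l2norm_left_regular.
  by apply: le_trans (pM _) _; rewrite l2norm_left_regular.
by rewrite big_const_seq count_predT iter_addr_0 -[leLHS]mulr_natl mulrA lexx.
Qed.

(** If the two families commute, the order in which one conjugates is
    irrelevant. *)
Lemma conj_bound_mulr q p t M :
  (forall s r, s \in q -> r \in p -> (s * r = r * s)%g) ->
  conj_bound q t M -> conj_bound (mul_seq q p) t ((size p)%:R * M).
Proof.
move=> comm /(conj_bound_mull p) qM v.
have -> : \sum_(s <- mul_seq q p) left_regular (s * t * s^-1)%g v =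
          \sum_(s <- mul_seq p q) left_regular (s * t * s^-1)%g v.
  rewrite !big_allpairs_dep /= exchange_big /= !big_seq; apply: eq_bigr => r rp.
  by rewrite !big_seq; apply: eq_bigr => s sq; rewrite (comm s r).
exact: qM.
Qed.

End ConjugateAverages.

Section FullGroupPowers.
Variables (R : realType) (Gamma : groupType) (X : topologicalType).
Variable a : homeo_action Gamma X.
Hypothesis zdX : zero_dimensional X.
Hypothesis perfX : forall x : X, ~ open [set x].
Local Notation G := (full_group a).
Hypothesis noH : forall U : set X, clopen U -> U !=set0 ->
  ~ left_invariant_mean R (@rigid_stabilizer _ _ a U).
Implicit Types (U V : set X) (t s : G).

(** Write s t s^-1 = s (t s^-1 t^-1) t.  The last factor is an isometry, and
    [fell_bound] applies to the rigid stabilizers of U and t U. *)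
Lemma displaced_conj_bound U t (e : R) : clopen U -> U !=set0 ->
  (forall y, U y -> ~ U (t y)) -> 0 < e ->
  exists p, [/\ forall s, s \in p -> rigid_stabilizer U s,
    0 < (size p)%:R :> R & conj_bound p t (e * (size p)%:R)].
Proof.
move=> cU U0 tU e0; have subU := @rigid_stabilizer_subgroup _ _ a U.
have [p [pU p0 pe]] := nonamenable_small_norm subU (noH cU U0) e0.
exists p; split=> // v.
pose V := [set x | U (t^-1%g x)].
have UV : U `&` V = set0.
  apply/seteqP; split=> // x [Ux Vx]; have := tU _ Vx.
  by rewrite full_groupKV.
pose phi s := (t * s^-1 * t^-1)%g.
have phiV s : rigid_stabilizer U s -> rigid_stabilizer V (phi s).
  move=> sU x Vx; rewrite /phi !full_groupM.
  have [_ _ /(_ _ sU) sVU] := subU.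
  by rewrite sVU// full_groupKV.
rewrite -(l2norm_left_regular t v).
have -> : \sum_(s <- p) left_regular (s * t * s^-1)%g v =
    \sum_(s <- p) left_regular (s * phi s)%g (left_regular t v).
  by apply: eq_bigr => s _; rewrite -left_regularM /phi !mulgA mulgVK.
apply: (fell_bound subU (@rigid_stabilizer_subgroup _ _ a V)) => //.
- by move=> h k; exact: rigid_stabilizer_comm.
- by move=> g; exact: rigid_stabilizer_trivial.
Qed.

Lemma clopen_avoid (E : seq X) (x : X) : x \notin E ->
  exists U, [/\ clopen U, U x & forall y, y \in E -> ~ U y].
Proof.
elim: E => [|e E IH].
  by move=> _; exists setT; split=> //; exact: clopenT.
rewrite inE negb_or => /andP[/zdX[W [cW Wx We]] /IH[U [cU Ux UE]]].
exists (U `&` W); split=> //; first exact: clopenI.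
by move=> y; rewrite inE => /predU1P[->|/UE nU] [].
Qed.

(** Induction on ts.  A point x moved by the new element t is added to the set E
    to be avoided; the family found for the other elements is then supported in
    a clopen V away from x, and t displaces a small clopen U around x that is
    disjoint from V.  The families supported in U and in V commute, so their
    product serves all the elements. *)
Lemma full_group_powers_avoiding (ts : seq G) (E : seq X) (e : R) :
  0 < e -> 1%g \notin ts ->
  exists p V, [/\ clopen V, forall x, x \in E -> ~ V x,
    forall s, s \in p -> rigid_stabilizer V s, 0 < (size p)%:R :> R &
    forall t, t \in ts -> conj_bound p t (e * (size p)%:R)].
Proof.
move=> e0; elim: ts E => [|t ts IH] E.
  move=> _; exists [:: 1%g], set0.
  split=> [|x _ []|s||//]; [exact: clopen0| |by []].
  by rewrite inE => /eqP ->.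
rewrite inE negb_or => /andP[t1 /IH{}IH].
have ct : continuous (t : X -> X) by exact: homeo_continuous.
pose O := [set x | t x <> x].
have oO : open O.
  rewrite openE => x /(displaced_clopen zdX ct)[U [[oU _] Ux Ut]].
  rewrite /interior; apply: filterS (open_nbhs_nbhs (conj oU Ux)) => y Uy ty.
  by apply: (Ut y Uy); rewrite ty.
have O0 : O !=set0.
  apply: contrapT => no; move: t1; rewrite eq_sym => /eqP; apply.
  apply: full_group_ext => x; rewrite full_group1; apply: contrapT => tx.
  by apply: no; exists x.
have [x Ox xE] := open_avoid E zdX perfX oO O0.
have [p [V [cV VE pV p0 pe]]] := IH (x :: E).
have [U0 [cU0 U0x U0t]] := displaced_clopen zdX ct Ox.
have [C [cC Cx CE]] := clopen_avoid xE.
pose U := (U0 `&` C) `\` V.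
have cU : clopen U by apply: clopenD => //; exact: clopenI.
have Ux : U x by split=> //; apply: VE; exact: mem_head.
have UV : U `&` V = set0 by apply/seteqP; split=> // y [[_ nV] Vy].
have Ut y : U y -> ~ U (t y) by move=> [[/U0t nU _] _] [[]].
have [q [qU q0 qe]] := displaced_conj_bound cU (ex_intro _ _ Ux) Ut e0.
have sz : (size (mul_seq q p))%:R = (size q)%:R * (size p)%:R :> R.
  by rewrite size_allpairs natrM.
exists (mul_seq q p), (U `|` V); split.
- exact: clopenU.
- move=> y yE [[[_ Cy] _]|]; first exact: (CE y).
  by apply: VE; rewrite inE yE orbT.
- apply: mul_seq_sub; first exact: rigid_stabilizer_subgroup.
    by move=> s /qU; apply: rigid_stabilizer_sub; exact: subsetUl.
  by move=> s /pV; apply: rigid_stabilizer_sub; exact: subsetUr.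
- by rewrite sz mulr_gt0.
move=> r; rewrite inE sz => /predU1P[->|/pe].
  have -> : e * ((size q)%:R * (size p)%:R) =
    (size p)%:R * (e * (size q)%:R) by ring.
  apply: conj_bound_mulr => // s r' /qU sU /pV rV.
  exact: rigid_stabilizer_comm UV sU rV.
have -> : e * ((size q)%:R * (size p)%:R) =
  (size q)%:R * (e * (size p)%:R) by ring.
exact: conj_bound_mull.
Qed.

Lemma full_group_powers : powers_property R G.
Proof.
move=> ts ts1 e e0.
have [p [V [_ _ _ p0 pe]]] := full_group_powers_avoiding [::] e0 ts1.
by exists p.
Qed.

End FullGroupPowers.

Theorem theorem1p13 (R : realType) (Gamma : groupType) (X : topologicalType)
    (a : homeo_action Gamma X) :
  countable [set: Gamma]%classic ->
  ~ amenable R Gamma ->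
  is_cantor_set X ->
  free_action a ->
  minimal_action a ->
  Cstar_simple R (full_group a).
Proof.
move=> _ namen cantorX freea mina.
have [cX zdX perfX] := cantor_set_stone cantorX.
apply: powers_Cstar_simple; apply: full_group_powers => // U cU U0 mean.
exact: namen (rigid_stabilizer_mean cX zdX freea mina cU U0 mean).
Qed.
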